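(* Let $N\in\mathbb N$, let $d\in\mathbb Z$, and let $C$ be a chain complex of free $\mathbb Z^N$-persistence modules of finite total rank. Let $\zeta\in\mathbb Z^N$ satisfy $\zeta\ge z$ for every $e\in\mathbb Z$ and every $z\in\operatorname{rk}C_e$, and let $\hat C$ and $R$ be the chain complex and the functor defined from $\zeta$ (see context). If $G$ is a minimal free resolution of $H^{d+N}(\hat C^\dagger)$, then $R(G[N]^\dagger)$, viewed as a chain complex, is a minimal free resolution of $H_d(C)$.
   Context: Fix a field $\mathbb F$ and $N\in\mathbb N$; $\mathbb Z^N$ carries the product partial order. A $\mathbb Z^N$-persistence module is a functor $M$ from the poset $\mathbb Z^N$ to finite-dimensional $\mathbb F$-vector spaces, with components $M_z$; morphisms are natural transformations, and $\operatorname{Hom}(L,M)$ is the vector space of morphisms. Kernels, cokernels and (co)homology are computed componentwise. The shift $M\langle z\rangle$ has components $M\langle z\rangle_w=M_{z+w}$. For $z\in\mathbb Z^N$, $F(z)$ is the persistence module with $F(z)_v=\mathbb F$ if $z\le v$ and $0$ otherwise, with identities between nonzero components. A persistence module $M$ is free if $M\cong\bigoplus_{z\in Q}F(z)$ for a multiset $Q$ of elements of $\mathbb Z^N$; the multiset $Q$ is unique and denoted $\operatorname{rk}M$. A complex $C$ has finite total rank if $\sum_e|\operatorname{rk}C_e|<\infty$. Global dual: with $\mathbf 1=(1,\dotsc,1)$, $(M^\dagger)_z=\operatorname{Hom}(M,F(\mathbf 1)\langle z\rangle)=\operatorname{Hom}(M,F(\mathbf 1-z))$ with induced structure maps; in particular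 $F(z)^\dagger\cong F(\mathbf 1-z)$. It is contravariant and applied degreewise to complexes: $(C^\dagger)^d=(C_d)^\dagger$. A free resolution of $M$ is a chain complex $G$ of free modules concentrated in nonnegative degrees together with a morphism $\varepsilon\colon G_0\to M$ such that $\dotsb\to G_1\to G_0\xrightarrow{\varepsilon} M\to 0$ is exact. A homological ball is a chain complex $\dotsb\to0\to F(z)\xrightarrow{\mathrm{id}}F(z)\to0\to\dotsb$ concentrated in two consecutive degrees. A chain complex of finite rank free modules is minimal if it has no homological ball as a direct summand; a minimal free resolution is a free resolution (by finite rank free modules) that is minimal as a chain complex. $G[N]$ is the shifted complex $G[N]_d=G_{d+N}$; $G[N]^\dagger$ is the cochain complex with $(G[N]^\dagger)^d=(G_{d+N})^\dagger$, viewed as a chain complex via $D_d=D^{-d}$, so its component in homological degree $d$ is $(G_{N-d})^\dagger$. Construction of $\hat C$: write $[N]=\{1,\dotsc,N\}$. For $S\subseteq[N]$ let $P_S$ be the functor with $(P_SM)_z=M_z$ if $z_i>\zeta_i$ for all $i\in S$ and $(P_SM)_z=0$ otherwise, with the obvious structure maps. For $S'\supseteq S$ there are inclusions $P_{S'}M\hookrightarrow P_SM$. Set $P_kM=\bigoplus_{S\subseteq[N],|S|=k}P_SM$ and make these into a chain complex whose differential $P_kM\to P_{k-1}M$ has nonzero components $(-1)^j$ times the inclusion $P_SM\hookrightarrow P_{S\setminus\{s_j\}}M$ for $S=\{s_1<\dotsb<s_k\}$. Applied degreewise to $C$ this gives a double complex with entries $P_iC_j$, and $\hat C$ is its total complex: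 $\hat C_d=\bigoplus_{S\subseteq[N]}P_SC_{d-|S|}$, with boundary the sum of the horizontal maps $P_iC_j\to P_{i-1}C_j$ and $(-1)^i$ times the vertical maps $P_i(\partial_j)\colon P_iC_j\to P_iC_{j-1}$. The functor $R$ on persistence modules is $(RM)_z=M_{z\wedge\zeta}$, where $\wedge$ is the componentwise minimum, with the obvious structure maps; it is applied degreewise to complexes. *)

(* Defs.v *)
From HB Require Import structures.
From mathcomp Require Import all_boot all_order all_algebra.
From mathcomp Require Import ring_quotient boolp functions.
From mathcomp Require Import zify.

Set Implicit Arguments.
Unset Strict Implicit.
Unset Printing Implicit Defensive.
Import Order.TTheory GRing.Theory Num.Theory.
Local Open Scope ring_scope.

Section Submodules.
Variable F : fieldType.
Implicit Types V W : lmodType F.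

Record submod V := Submod {
  submod_pred :> V -> Prop;
  submod_has0 : submod_pred 0;
  submod_lin : forall a u v,
    submod_pred u -> submod_pred v -> submod_pred (a *: u + v) }.

Definition carrier V (A : submod V) : {pred V} := fun x => `[< A x >].

Lemma carrierP V (A : submod V) x : reflect (A x) (x \in carrier A).
Proof. exact: asboolP. Qed.

Lemma carrier_closed V (A : submod V) : subsemimod_closed (carrier A).
Proof.
apply/GRing.submod_closed_semi; split; first by apply/carrierP/submod_has0.
by move=> a u v /carrierP Au /carrierP Av; apply/carrierP/submod_lin.
Qed.

HB.instance Definition _ V (A : submod V) :=
  GRing.isSubmodClosed.Build F V (carrier A) (carrier_closed A).

Definition subm V (A : submod V) := {x : V | x \in carrier A}.
HB.instance Definition _ V (A : submod V) := SubChoice.on (subm A).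
HB.instance Definition _ V (A : submod V) :=
  [SubChoice_isSubLmodule of subm A by <:].

Lemma subm_in V (A : submod V) (x : subm A) : A (val x).
Proof. exact/carrierP/(valP x). Qed.

Definition mkSub V (A : submod V) x (Ax : A x) : subm A :=
  Sub x (introT (carrierP A x) Ax).

Definition mkLin V W (f : V -> W) (fl : linear f) : {linear V -> W} :=
  HB.pack f (GRing.isLinear.Build F V W *:%R f fl).

Section SubMap.
Variables (V W : lmodType F) (A : submod V) (B : submod W).
Variables (f : {linear V -> W}) (fAB : forall x, A x -> B (f x)).

Definition sub_fun (x : subm A) : subm B := mkSub (fAB (subm_in x)).

Lemma sub_fun_linear : linear sub_fun.
Proof. by move=> a x y; apply: val_inj; rewrite /= linearP. Qed.

HB.instance Definition _ :=
  GRing.isLinear.Build F (subm A) (subm B) *:%R sub_fun sub_fun_linear.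

Definition sub_map : {linear subm A -> subm B} := sub_fun.

End SubMap.

Section Quotient.
Local Open Scope quotient_scope.
Variables (V : lmodType F) (A : submod V).

Definition quom := {ideal_quot (carrier A)}.
HB.instance Definition _ := GRing.Zmodule.on quom.

Definition qpi (x : V) : quom := \pi_({ideal_quot (carrier A)}) x.
Definition qrepr (x : quom) : V := repr (x : {ideal_quot (carrier A)}).

Lemma qreprK x : qpi (qrepr x) = x. Proof. exact: reprK. Qed.

Lemma qpi_eq x y : qpi x = qpi y <-> A (x - y).
Proof.
split=> [/eqP|Axy]; first by rewrite -Quotient.idealrBE => /carrierP.
by apply/eqP; rewrite -Quotient.idealrBE; apply/carrierP.
Qed.

Lemma qpiD x y : qpi (x + y) = qpi x + qpi y.
Proof. exact: Quotient.pi_add. Qed.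

Lemma submodZ a x : A x -> A (a *: x).
Proof.
by move=> Ax; rewrite -[_ *: _]addr0; apply: submod_lin => //; apply: submod_has0.
Qed.

Definition qscale (a : F) (x : quom) : quom := qpi (a *: qrepr x).

Lemma qpiZ a x : qpi (a *: x) = qscale a (qpi x).
Proof.
by apply/qpi_eq; rewrite -scalerBr; apply/submodZ/qpi_eq; rewrite qreprK.
Qed.

Fact qscaleA a b v : qscale a (qscale b v) = qscale (a * b) v.
Proof. by rewrite -[v]qreprK -!qpiZ scalerA. Qed.
Fact qscale1 : left_id 1 qscale.
Proof. by move=> v; rewrite -[v]qreprK -!qpiZ scale1r. Qed.
Fact qscaleDr : right_distributive qscale +%R.
Proof.
by move=> a u v; rewrite -[v]qreprK -[u]qreprK -qpiD -!qpiZ -qpiD scalerDr.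
Qed.
Fact qscaleDl v : {morph qscale^~ v : a b / a + b}.
Proof. by move=> a b; rewrite -[v]qreprK -!qpiZ -qpiD scalerDl. Qed.

HB.instance Definition _ := GRing.Zmodule_isLmodule.Build F quom
  qscaleA qscale1 qscaleDr qscaleDl.

Lemma qpi_linear : linear qpi.
Proof. by move=> a x y; rewrite qpiD qpiZ. Qed.

End Quotient.

HB.instance Definition _ V (A : submod V) :=
  GRing.isLinear.Build F V (quom A) *:%R (@qpi V A) (@qpi_linear V A).

Section QuotientMap.
Variables (V W : lmodType F) (A : submod V) (B : submod W).
Variables (f : {linear V -> W}) (fAB : forall x, A x -> B (f x)).

Definition quo_fun (x : quom A) : quom B := qpi B (f (qrepr x)).

Lemma quo_funE x : quo_fun (qpi A x) = qpi B (f x).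
Proof. by apply/qpi_eq; rewrite -linearB; apply/fAB/qpi_eq; rewrite qreprK. Qed.

Lemma quo_fun_linear : linear quo_fun.
Proof.
move=> a x y; rewrite -[x]qreprK -[y]qreprK -linearP !quo_funE.
by rewrite !linearP.
Qed.

HB.instance Definition _ :=
  GRing.isLinear.Build F (quom A) (quom B) *:%R quo_fun quo_fun_linear.

Definition quo_map : {linear quom A -> quom B} := quo_fun.

End QuotientMap.

Section Product.
Variables (I : Type) (V : I -> lmodType F).

Definition dprod := forall i, V i.
HB.instance Definition _ := Choice.on dprod.

Implicit Types f g h : dprod.
Definition dp_zero : dprod := fun i => 0.
Definition dp_add f g : dprod := fun i => f i + g i.
Definition dp_opp f : dprod := fun i => - f i.
Definition dp_scale (a : F) f : dprod := fun i => a *: f i.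

Fact dp_addA : associative dp_add.
Proof. by move=> f g h; apply: functional_extensionality_dep => i; apply: addrA. Qed.
Fact dp_addC : commutative dp_add.
Proof. by move=> f g; apply: functional_extensionality_dep => i; apply: addrC. Qed.
Fact dp_add0 : left_id dp_zero dp_add.
Proof. by move=> f; apply: functional_extensionality_dep => i; apply: add0r. Qed.
Fact dp_addN : left_inverse dp_zero dp_opp dp_add.
Proof. by move=> f; apply: functional_extensionality_dep => i; apply: addNr. Qed.
HB.instance Definition _ :=
  GRing.isZmodule.Build dprod dp_addA dp_addC dp_add0 dp_addN.

Fact dp_scaleA a b f : dp_scale a (dp_scale b f) = dp_scale (a * b) f.
Proof. by apply: functional_extensionality_dep => i; apply: scalerA. Qed.
Fact dp_scale1 : left_id 1 dp_scale.
Proof. by move=> f; apply: functional_extensionality_dep => i; apply: scale1r. Qed.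
Fact dp_scaleDr : right_distributive dp_scale +%R.
Proof. by move=> a f g; apply: functional_extensionality_dep => i; apply: scalerDr. Qed.
Fact dp_scaleDl f : {morph dp_scale^~ f : a b / a + b}.
Proof. by move=> a b; apply: functional_extensionality_dep => i; apply: scalerDl. Qed.
HB.instance Definition _ := GRing.Zmodule_isLmodule.Build F dprod
  dp_scaleA dp_scale1 dp_scaleDr dp_scaleDl.

Lemma dp0E i : (0 : dprod) i = 0. Proof. by []. Qed.
Lemma dpDE f g i : (f + g) i = f i + g i. Proof. by []. Qed.
Lemma dpZE a f i : (a *: f) i = a *: f i. Proof. by []. Qed.

End Product.

End Submodules.

Definition grade (N : nat) := {ffun 'I_N -> int}.
HB.instance Definition _ N := GRing.Zmodule.on (grade N).

Definition zle N (z w : grade N) : bool := [forall i, z i <= w i].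
Definition zmeet N (z w : grade N) : grade N := [ffun i => Num.min (z i) (w i)].
Definition zone N : grade N := [ffun => 1].

Lemma zleP N (z w : grade N) : reflect (forall i, z i <= w i) (zle z w).
Proof. exact: forallP. Qed.

Lemma zle_trans N (z w v : grade N) : zle z w -> zle w v -> zle z v.
Proof.
by move=> /zleP zw /zleP wv; apply/zleP => i; apply: le_trans (zw i) (wv i).
Qed.

Lemma zleD2l N (z w v : grade N) : zle w v -> zle (z + w) (z + v).
Proof. by move=> /zleP wv; apply/zleP => i; rewrite !ffunE lerD2l. Qed.

Lemma zleD2r N (z w v : grade N) : zle z w -> zle (z + v) (w + v).
Proof. by move=> /zleP wv; apply/zleP => i; rewrite !ffunE lerD2r. Qed.

Lemma zle_meet N (z w v : grade N) : zle z w -> zle (zmeet z v) (zmeet w v).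
Proof.
move=> /zleP zw; apply/zleP => i; rewrite !ffunE.
by rewrite le_min !ge_min zw lexx orbT.
Qed.

(* Functors from Z^N to all F-vector spaces.  Pointwise finite-dimensionality
   is not part of the record because the global dual does not preserve it; it
   is automatic for free modules of finite rank and for subquotients and
   direct summands of these. *)
Record pmod (F : fieldType) (N : nat) := Pmod {
  pobj :> grade N -> lmodType F;
  pmap : forall z w, zle z w -> {linear pobj z -> pobj w};
  pmap_id : forall z (h : zle z z) x, pmap h x = x;
  pmap_comp : forall z w v (h1 : zle z w) (h2 : zle w v) (h3 : zle z v) x,
    pmap h2 (pmap h1 x) = pmap h3 x }.

Section Hom.
Variables (F : fieldType) (N : nat).
Implicit Types M L K : pmod F N.

(* The vector space Hom(M, L) of natural transformations, as a subspace of the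
   space of families of functions M z -> L z. *)
Definition is_hom M L (f : dprod (fun z => M z -> L z : lmodType F)) : Prop :=
  (forall z, linear (f z)) /\
  (forall z w (h : zle z w) x, f w (pmap M h x) = pmap L h (f z x)).

Lemma is_hom0 M L : @is_hom M L 0.
Proof.
split=> [z a x y|z w h x] /=; rewrite !dp0E /GRing.zero /=.
  by rewrite scaler0 addr0.
by rewrite linear0.
Qed.

Lemma is_hom_lin M L a f g :
  @is_hom M L f -> @is_hom M L g -> is_hom (a *: f + g).
Proof.
move=> [fl fn] [gl gn]; split=> [z b x y|z w h x].
  rewrite dpDE dpZE !fctE fl gl !scalerDr !scalerA mulrC -!addrA.
  by congr (_ + _); rewrite addrCA.
by rewrite !dpDE !dpZE !fctE fn gn linearP.
Qed.

Definition Hom_submod M L := Submod (is_hom0 M L) (@is_hom_lin M L).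
Definition Hom M L := subm (Hom_submod M L).
HB.instance Definition _ M L := GRing.Lmodule.on (Hom M L).

Definition hom_at M L (f : Hom M L) : forall z, M z -> L z := val f.
Arguments hom_at [M L] f z _ : rename.
Coercion hom_at : Hom >-> Funclass.

Lemma hom_linear M L (f : Hom M L) z : linear (f z).
Proof. by case: (subm_in f). Qed.

HB.instance Definition _ M L (f : Hom M L) z :=
  GRing.isLinear.Build F (M z) (L z) *:%R (hom_at f z) (@hom_linear M L f z).

Definition hom_lin M L (f : Hom M L) z : {linear M z -> L z} := hom_at f z.

Lemma hom_nat M L (f : Hom M L) z w (h : zle z w) x :
  f w (pmap M h x) = pmap L h (f z x).
Proof. by case: (subm_in f) => _ fn; apply: fn. Qed.

Lemma homP M L (f g : Hom M L) : (forall z x, f z x = g z x) -> f = g.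
Proof.
move=> fg; apply: val_inj; apply: functional_extensionality_dep => z.
by apply: functional_extensionality_dep => x; apply: fg.
Qed.

Lemma hom0E M L z x : (0 : Hom M L) z x = 0. Proof. by []. Qed.
Lemma homDE M L (f g : Hom M L) z x : (f + g : Hom M L) z x = f z x + g z x.
Proof. by []. Qed.
Lemma homZE M L a (f : Hom M L) z x : (a *: f : Hom M L) z x = a *: f z x.
Proof. by []. Qed.

Definition mkHom M L (f : forall z, {linear M z -> L z})
    (fn : forall z w (h : zle z w) x, f w (pmap M h x) = pmap L h (f z x)) :
  Hom M L.
Proof.
refine (@mkSub F _ (Hom_submod M L) (fun z => f z) _).
by split=> // z a x y; rewrite linearP.
Defined.

Definition hid M : Hom M M.
Proof. by refine (@mkHom M M (fun z => idfun) _). Defined.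

Definition hcomp M L K (g : Hom L K) (f : Hom M L) : Hom M K.
Proof.
refine (@mkHom M K (fun z => (hom_at g z \o hom_at f z)%FUN) _).
by move=> z w h x /=; rewrite !hom_nat.
Defined.

Lemma hcompE M L K (g : Hom L K) (f : Hom M L) z x :
  hcomp g f z x = g z (f z x).
Proof. by []. Qed.

Lemma hcomp_linearr M L K (g : Hom L K) : linear (@hcomp M L K g).
Proof.
move=> a x y; apply: homP => z u.
by rewrite homDE homZE !hcompE homDE homZE (linearP (hom_at g z)).
Qed.

Lemma hcomp_linearl M L K (f : Hom M L) : linear (fun g : Hom L K => hcomp g f).
Proof. by move=> a x y; apply: homP => z u. Qed.

Lemma hcompA M L K J (h : Hom K J) (g : Hom L K) (f : Hom M L) :
  hcomp h (hcomp g f) = hcomp (hcomp h g) f.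
Proof. exact: homP. Qed.

Lemma hcomp0r M L K (g : Hom L K) : hcomp g (0 : Hom M L) = 0.
Proof. by apply: homP => z x; rewrite hcompE !hom0E (linear0 (hom_lin g z)). Qed.

Lemma hom_sumE M L (I : finType) (P : pred I) (f : I -> Hom M L) z x :
  hom_at (\sum_(i | P i) f i) z x = \sum_(i | P i) hom_at (f i) z x.
Proof. by apply: (big_morph (fun g : Hom M L => hom_at g z x)). Qed.

Definition piso M L : Prop :=
  exists (f : Hom M L) (g : Hom L M), hcomp g f = hid M /\ hcomp f g = hid L.

End Hom.

Arguments hom_at {F N M L} f z _ : rename.
Arguments hom_lin {F N M L} f z : rename.

Section Constructions.
Variables (F : fieldType) (N : nat).
Implicit Types M L K : pmod F N.

Definition psub M (A : forall z, submod (M z))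
    (st : forall z w (h : zle z w) x, A z x -> A w (pmap M h x)) : pmod F N.
Proof.
refine (@Pmod F N (fun z => subm (A z)) (fun z w h => sub_map (st z w h)) _ _).
- by move=> z h x; apply: val_inj; rewrite /= pmap_id.
- by move=> z w v h1 h2 h3 x; apply: val_inj; rewrite /= (pmap_comp _ _ h3).
Defined.

Definition pquo M (A : forall z, submod (M z))
    (st : forall z w (h : zle z w) x, A z x -> A w (pmap M h x)) : pmod F N.
Proof.
refine (@Pmod F N (fun z => quom (A z)) (fun z w h => quo_map (st z w h)) _ _).
- move=> z h x; rewrite -[x]qreprK /quo_map /= quo_funE; last exact: st.
  by rewrite pmap_id.
- move=> z w v h1 h2 h3 x; rewrite -[x]qreprK /quo_map /=.
  by rewrite !quo_funE ?(pmap_comp _ _ h3) //; apply: st.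
Defined.

Definition if_submod (V : lmodType F) (b : bool) : submod V.
Proof.
refine (@Submod F V (fun x => ~~ b -> x = 0) _ _) => //.
by move=> a u v u0 v0 nb; rewrite u0 // v0 // scaler0 addr0.
Defined.

Definition ptrunc M (U : grade N -> bool)
    (up : forall z w, zle z w -> U z -> U w) : pmod F N.
Proof.
refine (@psub M (fun z => if_submod (M z) (U z)) _).
move=> z w h x /= x0 nUw; rewrite x0 ?linear0 //.
by apply: contra nUw; apply: up.
Defined.

Lemma if_submod_hom M L (f : Hom M L) z (b c : bool) : (b -> c) ->
  forall x, if_submod (M z) b x -> if_submod (L z) c (f z x).
Proof.
by move=> bc x /= x0 nc; rewrite x0 ?linear0 //; apply: contra nc.
Qed.

Definition ptrunc_hom M L (U V : grade N -> bool) upU upV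
    (UV : forall z, U z -> V z) (f : Hom M L) :
  Hom (@ptrunc M U upU) (@ptrunc L V upV).
Proof.
refine (@mkHom F N (@ptrunc M U upU) (@ptrunc L V upV)
  (fun z => sub_map (if_submod_hom f (UV z))) _).
by move=> z w h x; apply: val_inj; rewrite /= hom_nat.
Defined.

Lemma ptrunc_homE M L U V upU upV UV (f : Hom M L) z x :
  val (@ptrunc_hom M L U V upU upV UV f z x) = f z (val x).
Proof. by []. Qed.

Definition pconst : pmod F N.
Proof. by refine (@Pmod F N (fun=> F^o) (fun _ _ _ => idfun) _ _). Defined.

Definition Fz (z : grade N) : pmod F N :=
  @ptrunc pconst (zle z) (fun w v wv zw => zle_trans zw wv).

Section DirectSum.
Variables (I : finType) (M : I -> pmod F N).

Definition dsum_fun z w (h : zle z w) (x : dprod (fun i => M i z)) :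
  dprod (fun i => M i w) := fun i => pmap (M i) h (x i).

Lemma dsum_fun_linear z w (h : zle z w) : linear (dsum_fun h).
Proof.
by move=> a x y; apply: functional_extensionality_dep => i; apply: linearP.
Qed.

(* The direct sum of a finite family, realized as its product. *)
Definition pdsum : pmod F N.
Proof.
refine (@Pmod F N (fun z => dprod (fun i => M i z))
  (fun z w h => mkLin (dsum_fun_linear h)) _ _).
- by move=> z h x; apply: functional_extensionality_dep => i; apply: pmap_id.
- move=> z w v h1 h2 h3 x; apply: functional_extensionality_dep => i.
  exact: pmap_comp.
Defined.

Lemma dsum_proj_linear i z : linear (fun x : pdsum z => x i).
Proof. by []. Qed.

Definition dsum_proj i : Hom pdsum (M i).
Proof.
by refine (@mkHom F N pdsum (M i) (fun z => mkLin (@dsum_proj_linear i z)) _).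
Defined.

Lemma dsum_pair_linear K (f : forall i, Hom K (M i)) z :
  linear (fun x : K z => (fun i => f i z x) : pdsum z).
Proof.
move=> a x y; apply: functional_extensionality_dep => i; exact: hom_linear.
Qed.

Definition dsum_pair K (f : forall i, Hom K (M i)) : Hom K pdsum.
Proof.
refine (@mkHom F N K pdsum (fun z => mkLin (@dsum_pair_linear K f z)) _).
move=> z w h x; apply: functional_extensionality_dep => i; exact: hom_nat.
Defined.

End DirectSum.

Section DirectSum2.
Variables M L : pmod F N.

Definition sum_fun z w (h : zle z w) (x : M z * L z) : M w * L w :=
  (pmap M h x.1, pmap L h x.2).

Lemma sum_fun_linear z w (h : zle z w) : linear (sum_fun h).
Proof. by move=> a x y; rewrite /sum_fun /= !linearP. Qed.

Definition psum : pmod F N.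
Proof.
refine (@Pmod F N (fun z => (M z * L z)%type)
  (fun z w h => mkLin (sum_fun_linear h)) _ _).
- by move=> z h [x y]; congr (_, _); apply: pmap_id.
- by move=> z w v h1 h2 h3 [x y]; congr (_, _); apply: pmap_comp.
Defined.

End DirectSum2.

Section DirectSum2Hom.
Variables (M L M' L' : pmod F N) (f : Hom M M') (g : Hom L L').

Lemma psum_hom_linear z :
  linear (fun x : psum M L z => (f z x.1, g z x.2) : psum M' L' z).
Proof. by move=> a x y; rewrite /= !hom_linear. Qed.

Definition psum_hom : Hom (psum M L) (psum M' L').
Proof.
refine (@mkHom F N (psum M L) (psum M' L')
  (fun z => mkLin (@psum_hom_linear z)) _).
by move=> z w h x; congr (_, _); apply: hom_nat.
Defined.

End DirectSum2Hom.

Definition pfree (Q : seq (grade N)) : pmod F N :=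
  pdsum (fun i : 'I_(size Q) => Fz (nth 0 Q i)).

(* rk M = Q, where the sequence Q stands for a finite multiset *)
Definition has_rank M (Q : seq (grade N)) : Prop := piso M (pfree Q).

Definition finite_free M : Prop := exists Q, has_rank M Q.

Definition pshift M (z : grade N) : pmod F N.
Proof.
refine (@Pmod F N (fun w => M (z + w)) (fun w v h => pmap M (zleD2l z h)) _ _).
- by move=> w h x; apply: pmap_id.
- by move=> w v u h1 h2 h3 x; apply: pmap_comp.
Defined.

Definition pshift_hom M z w (h : zle z w) : Hom (pshift M z) (pshift M w).
Proof.
refine (@mkHom F N (pshift M z) (pshift M w) (fun v => pmap M (zleD2r v h)) _).
move=> v u h' x /=.
have h3 : zle (z + v) (w + u) by apply: zle_trans (zleD2r v h) (zleD2l w h').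
by rewrite !(pmap_comp _ _ h3).
Defined.

Definition global_dual M : pmod F N.
Proof.
refine (@Pmod F N (fun z => Hom M (pshift (Fz (zone N)) z))
  (fun z w h => mkLin (hcomp_linearr (pshift_hom (Fz (zone N)) h))) _ _).
- move=> z h x; apply: homP => v u.
  exact: (@pmap_id F N (Fz (zone N)) (z + v) (zleD2r v h) (hom_at x v u)).
- move=> z w v h1 h2 h3 x; apply: homP => u y.
  exact: (@pmap_comp F N (Fz (zone N)) (z + u) (w + u) (v + u) (zleD2r u h1)
    (zleD2r u h2) (zleD2r u h3) (hom_at x u y)).
Defined.

Definition global_dual_hom M L (f : Hom M L) : Hom (global_dual L) (global_dual M).
Proof.
refine (@mkHom F N (global_dual L) (global_dual M)
  (fun z => mkLin (@hcomp_linearl F N M L (pshift (Fz (zone N)) z) f)) _).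
by move=> z w h g; apply: homP.
Defined.

Lemma global_dual_homE M L (f : Hom M L) z (g : global_dual L z) :
  global_dual_hom f z g = hcomp (g : Hom L (pshift (Fz (zone N)) z)) f.
Proof. by []. Qed.

Definition pR (zeta : grade N) M : pmod F N.
Proof.
refine (@Pmod F N (fun z => M (zmeet z zeta))
  (fun z w h => pmap M (zle_meet zeta h)) _ _).
- by move=> w h x; apply: pmap_id.
- by move=> w v u h1 h2 h3 x; apply: pmap_comp.
Defined.

Definition pR_hom zeta M L (f : Hom M L) : Hom (pR zeta M) (pR zeta L).
Proof.
refine (@mkHom F N (pR zeta M) (pR zeta L) (fun z => hom_lin f (zmeet z zeta)) _).
by move=> z w h x; exact: (hom_nat f (zle_meet zeta h) x).
Defined.

Definition above (zeta : grade N) (S : {set 'I_N}) (z : grade N) : bool :=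
  [forall i in S, zeta i < z i].

Lemma above_up zeta S z w : zle z w -> above zeta S z -> above zeta S w.
Proof.
move=> /zleP zw /forall_inP Sz; apply/forall_inP => i iS.
exact: lt_le_trans (Sz i iS) (zw i).
Qed.

Lemma above_sub zeta (S T : {set 'I_N}) : T \subset S ->
  forall z, above zeta S z -> above zeta T z.
Proof.
by move=> /subsetP TS z /forall_inP Sz; apply/forall_inP => i /TS; apply: Sz.
Qed.

Definition PS zeta S M : pmod F N := ptrunc M (@above_up zeta S).

(* P_S M -> P_T L induced by f : M -> L, for T \subset S: the composite of
   P_S f with the inclusion of P_S L into P_T L *)
Definition PS_hom zeta (S T : {set 'I_N}) (TS : T \subset S) M L
  (f : Hom M L) : Hom (PS zeta S M) (PS zeta T L) :=
  ptrunc_hom _ _ (above_sub TS) f.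

End Constructions.

(* The boundary is a family of maps C_i -> C_j for all i and j that vanishes
   unless i = j + 1; this avoids transports along equations between degrees. *)
Record complex (F : fieldType) (N : nat) := Complex {
  cobj :> int -> pmod F N;
  cdiff : forall i j, Hom (cobj i) (cobj j);
  cdiff_shape : forall i j, i != j + 1 -> cdiff i j = 0;
  cdiff_sq : forall i j k, hcomp (cdiff j k) (cdiff i j) = 0 }.

Section Complexes.
Variables (F : fieldType) (N : nat).
Implicit Types C D G : complex F N.
Implicit Types M L : pmod F N.

Lemma cdiffK C i j k z x : cdiff C j k z (cdiff C i j z x) = 0.
Proof. by have := cdiff_sq C i j k; move/(congr1 (fun f => hom_at f z x)). Qed.

Definition cycle_submod C (d : int) z : submod (C d z).
Proof.
refine (@Submod F (C d z) (fun x => cdiff C d (d - 1) z x = 0) _ _).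
- by rewrite linear0.
- by move=> a u v u0 v0; rewrite hom_linear u0 v0 scaler0 addr0.
Defined.

Lemma cycle_stable C d z w (h : zle z w) x :
  cycle_submod C d z x -> cycle_submod C d w (pmap (C d) h x).
Proof. by rewrite /= hom_nat => ->; rewrite linear0. Qed.

Definition cycles C d : pmod F N := psub (@cycle_stable C d).

Definition boundary_submod C (d : int) z : submod (cycles C d z).
Proof.
refine (@Submod F (cycles C d z)
  (fun x => exists y, cdiff C (d + 1) d z y = val x) _ _).
- by exists 0; rewrite linear0.
- move=> a u v [y uy] [y' vy]; exists (a *: y + y').
  by rewrite hom_linear uy vy.
Defined.

Lemma boundary_stable C d z w (h : zle z w) x :
  boundary_submod C d z x -> boundary_submod C d w (pmap (cycles C d) h x).
Proof. by move=> [y yx]; exists (pmap (C (d + 1)) h y); rewrite hom_nat yx. Qed.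

Definition homology C d : pmod F N := pquo (@boundary_stable C d).

(* A cochain complex D is represented by the chain complex with D_d = D^(-d). *)
Definition cohomology D d : pmod F N := homology D (- d).

(* The cochain complex with (C_d)^dagger in cohomological degree d, viewed as a
   chain complex *)
Definition cdual C : complex F N.
Proof.
refine (@Complex F N (fun d => global_dual (C (- d)))
  (fun i j => global_dual_hom (cdiff C (- j) (- i))) _ _).
- move=> i j ij; rewrite cdiff_shape.
    by apply: homP => z f; rewrite global_dual_homE hcomp0r.
  apply: contra ij => /eqP e; apply/eqP.
  by rewrite -[j]opprK e opprD opprK addrNK.
- move=> i j k; apply: homP => z f.
  by rewrite hcompE !global_dual_homE -hcompA cdiff_sq hcomp0r.
Defined.

Definition cshift C (n : int) : complex F N.
Proof.
refine (@Complex F N (fun d => C (d + n))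
  (fun i j => cdiff C (i + n) (j + n)) _ _).
- move=> i j ij; apply: cdiff_shape; apply: contra ij.
  by rewrite addrAC => /eqP/addIr/eqP.
- by move=> i j k; apply: cdiff_sq.
Defined.

Definition cR (zeta : grade N) C : complex F N.
Proof.
refine (@Complex F N (fun d => pR zeta (C d))
  (fun i j => pR_hom zeta (cdiff C i j)) _ _).
- by move=> i j ij; rewrite cdiff_shape //; apply: homP.
- by move=> i j k; apply: homP => z x; apply: cdiffK.
Defined.

Definition ccast C (i j : int) : Hom (C i) (C j) :=
  match i =P j with
  | ReflectT e => eq_rect i (fun k => Hom (C i) (C k)) (hid (C i)) j e
  | ReflectF _ => 0
  end.

Lemma ccast_id C i z x : ccast C i i z x = x.
Proof.
by rewrite /ccast; case: eqP => // e; rewrite (eq_irrelevance e (erefl i)).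
Qed.

Lemma ccast0 C i j : i != j -> ccast C i j = 0.
Proof. by rewrite /ccast; case: eqP. Qed.

Lemma ccast_comp C i j k z x : i = j \/ j = k ->
  ccast C j k z (ccast C i j z x) = ccast C i k z x.
Proof. by case=> <-; rewrite ccast_id. Qed.

Lemma ccast_diff C a b c d z x : a = b -> c = d ->
  cdiff C b d z (ccast C a b z x) = ccast C c d z (cdiff C a c z x).
Proof. by move=> <- <-; rewrite !ccast_id. Qed.

Section Hat.
Variables (zeta : grade N) (C : complex F N).

Definition hat_obj (d : int) : pmod F N :=
  pdsum (fun S : {set 'I_N} => PS zeta S (C (d - #|S|%:Z))).

(* For S = {s_1 < ... < s_k}, this is j if s = s_j. *)
Definition position (s : 'I_N) (S : {set 'I_N}) : nat :=
  #|[set t in S | (t <= s)%N]|.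

(* The component in P_T C_(j - |T|) of the boundary: P_T C_(j - |T|) receives
   (-1)^(position of s) times the inclusion of P_S C_(i - |S|) for each
   S = T :|: [set s] with s \notin T, and (-1)^|T| P_T of the boundary of C.
   For i = j + 1, i - |S| and j - |T| are equal and [ccast] is the identity. *)
Definition hat_comp (i j : int) (T : {set 'I_N}) :
    Hom (hat_obj i) (PS zeta T (C (j - #|T|%:Z))) :=
  \sum_(s | s \notin T)
    (-1) ^+ position s (s |: T) *:
      hcomp (PS_hom zeta (subsetUr [set s] T)
               (ccast C (i - #|s |: T|%:Z) (j - #|T|%:Z)))
            (dsum_proj (fun S => PS zeta S (C (i - #|S|%:Z))) (s |: T))
  + (-1) ^+ #|T| *:
      hcomp (PS_hom zeta (subxx T) (cdiff C (i - #|T|%:Z) (j - #|T|%:Z)))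
            (dsum_proj (fun S => PS zeta S (C (i - #|S|%:Z))) T).

Definition hat_diff i j : Hom (hat_obj i) (hat_obj j) :=
  dsum_pair (hat_comp i j).

Lemma hat_diffE i j z (x : hat_obj i z) (T : {set 'I_N}) :
  val (hat_diff i j z x T) =
  \sum_(s | s \notin T) (-1) ^+ position s (s |: T) *:
     ccast C (i - #|s |: T|%:Z) (j - #|T|%:Z) z (val (x (s |: T)))
  + (-1) ^+ #|T| *: cdiff C (i - #|T|%:Z) (j - #|T|%:Z) z (val (x T)).
Proof.
have -> : hat_diff i j z x T = hat_comp i j T z x by [].
by rewrite /hat_comp homDE hom_sumE homZE raddfD raddf_sum.
Qed.

Lemma card_setU1 (s : 'I_N) (T : {set 'I_N}) :
  s \notin T -> #|s |: T| = #|T|.+1.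
Proof. by move=> sT; rewrite cardsU1 sT. Qed.

Lemma deg_setU1 (a b : int) (s : 'I_N) (T : {set 'I_N}) :
  a = b + 1 -> s \notin T -> a - #|s |: T|%:Z = b - #|T|%:Z.
Proof. by move=> -> sT; rewrite card_setU1 //; lia. Qed.

Lemma hat_shape i j : i != j + 1 -> hat_diff i j = 0.
Proof.
move=> ij; apply: homP => z x; apply: functional_extensionality_dep => T.
apply: val_inj; rewrite hat_diffE cdiff_shape ?hom0E ?scaler0 ?addr0.
  rewrite big1 // => s sT; rewrite ccast0 ?hom0E ?scaler0 //.
  rewrite card_setU1 //; apply: contra ij => /eqP e; apply/eqP; lia.
by apply: contra ij => /eqP e; apply/eqP; lia.
Qed.

Lemma position_anti (s t : 'I_N) (T : {set 'I_N}) :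
  s \notin T -> t \notin T -> (s < t)%N ->
  ((-1) ^+ position s (s |: T) * (-1) ^+ position t (t |: (s |: T)) =
    - ((-1) ^+ position t (t |: T) * (-1) ^+ position s (s |: (t |: T))) :> F).
Proof.
move=> sT tT st.
have -> : position t (t |: (s |: T)) = (position t (t |: T)).+1.
  rewrite /position (_ : [set _ in _ | _] =
    s |: [set u in t |: T | (u <= t)%N]); last first.
    apply/setP => u; rewrite !inE; case: (u =P s) => [->|_] //=.
    by rewrite ltnW // orbT.
  rewrite card_setU1 // !inE negb_and negb_or sT andbT.
  by rewrite -val_eqE /= neq_ltn st.
have -> : position s (s |: (t |: T)) = position s (s |: T).
  apply: eq_card => u; rewrite !inE; case: (u =P t) => [->|_] //=.
  by rewrite (leqNgt t s) st !andbF.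
by rewrite exprS mulN1r mulrN mulrC.
Qed.

Lemma hat_sq i j k : hcomp (hat_diff j k) (hat_diff i j) = 0.
Proof.
have [ij|ij] := eqVneq i (j + 1); last first.
  by rewrite (hat_shape ij) hcomp0r.
have [jk|jk] := eqVneq j (k + 1); last first.
  by rewrite (hat_shape jk); apply: homP => z x; rewrite hcompE hom0E.
apply: homP => z x; apply: functional_extensionality_dep => T.
apply: val_inj; rewrite hcompE hat_diffE hat_diffE.
pose Y (S : {set 'I_N}) := ccast C (i - #|S|%:Z) (k - #|T|%:Z) z (val (x S)).
pose B (s : 'I_N) := (-1) ^+ position s (s |: T) *: ((-1) ^+ #|s |: T| *:
  ccast C (j - #|s |: T|%:Z) (k - #|T|%:Z) z
    (cdiff C (i - #|s |: T|%:Z) (j - #|s |: T|%:Z) z (val (x (s |: T))))).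
pose g (s t : 'I_N) : C (k - #|T|%:Z) z :=
  ((-1) ^+ position s (s |: T) * (-1) ^+ position t (t |: (s |: T))) *:
    Y (t |: (s |: T)).
rewrite (_ : \sum_(s | _) _ =
  \sum_(s | s \notin T) (\sum_(t | t \notin s |: T) g s t + B s)); last first.
  apply: eq_bigr => s sT.
  rewrite hat_diffE (linearD (hom_lin (ccast C _ _) z)) /=.
  rewrite (linear_sum (hom_lin (ccast C _ _) z)) /= scalerDr scaler_sumr.
  congr (_ + _).
    apply: eq_bigr => t tsT.
    rewrite (linearZ_LR (hom_lin (ccast C _ _) z)) /= scalerA.
    by rewrite ccast_comp //; left; apply: deg_setU1.
  by rewrite (linearZ_LR (hom_lin (ccast C _ _) z)).
rewrite (linearD (hom_lin (cdiff C _ _) z)) /=.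
rewrite (linear_sum (hom_lin (cdiff C _ _) z)) /=.
rewrite (linearZ_LR (hom_lin (cdiff C _ _) z)) /= cdiffK scaler0 addr0.
rewrite scaler_sumr big_split /= -addrA -big_split /=.
rewrite [X in _ + X = _]big1 ?addr0; last first.
  move=> s sT; rewrite /B (linearZ_LR (hom_lin (cdiff C _ _) z)) /=.
  rewrite (@ccast_diff _ _ _ (j - #|s |: T|%:Z) (k - #|T|%:Z)).
  - set y := ccast C _ _ _ _; rewrite (_ : (-1) ^+ #|s |: T| = (-1) ^+ #|T|.+1 :> F);
      last by rewrite card_setU1.
    rewrite exprS mulN1r scaleNr scalerN !scalerA mulrC.
    by rewrite addNr.
  - exact: deg_setU1.
  - exact: deg_setU1.
have gN s t : s \notin T -> t \notin T -> (s < t)%N -> g s t = - g t s.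
  move=> sT tT st; rewrite /g -scaleNr -position_anti //.
  by rewrite setUCA.
rewrite (_ : \sum_(s | _) _ =
  \sum_(s | s \notin T) (\sum_(t | (t \notin T) && (s < t)%N) g s t +
    \sum_(t | (t \notin T) && (t < s)%N) g s t)); last first.
  apply: eq_bigr => s sT.
  rewrite (bigID (fun t : 'I_N => (s < t)%N)) /=; congr (_ + _);
    apply: eq_bigl => t; rewrite !inE negb_or -val_eqE /=;
    by case: (ltngtP s t); rewrite ?andbF ?andbT.
rewrite big_split /= [X in _ + X = _](exchange_big_dep (fun t => t \notin T)) /=;
  last by move=> s t _ /andP[].
rewrite -big_split big1 //= => s sT.
rewrite (_ : \sum_(t | [&& t \notin T, s \notin T & (s < t)%N]) g t s =
             - \sum_(t | (t \notin T) && (s < t)%N) g s t) ?addrN //.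
rewrite -sumrN; apply: eq_big => [t|t /and3P[tT _ st]].
  by rewrite sT.
by rewrite (gN s t) ?opprK.
Qed.

Definition hat : complex F N := Complex hat_shape hat_sq.

End Hat.

(* In the homological ball the zero objects are F(z) truncated to the empty set
   of grades, so that [ball_diff] is induced by an endomorphism of F(z). *)
Definition ball_deg (k i : int) (_ : grade N) : bool := (i == k + 1) || (i == k).

Lemma ball_deg_up k i (z w : grade N) :
  zle z w -> ball_deg k i z -> ball_deg k i w.
Proof. by []. Qed.

Definition ball_obj (z : grade N) k i : pmod F N :=
  ptrunc (Fz F z) (@ball_deg_up k i).

Definition ball_map (z : grade N) (k i j : int) : Hom (Fz F z) (Fz F z) :=
  if (i == k + 1) && (j == k) then hid (Fz F z) else 0.

Lemma ball_map_in (z : grade N) k i j w x :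
  if_submod (Fz F z w) (ball_deg k i w) x ->
  if_submod (Fz F z w) (ball_deg k j w) (ball_map z k i j w x).
Proof.
rewrite /ball_map; case: ifP => [/andP[_ jk] _|_ _] /=.
  by rewrite /ball_deg jk orbT.
by rewrite hom0E.
Qed.

Definition ball_diff (z : grade N) k i j : Hom (ball_obj z k i) (ball_obj z k j).
Proof.
refine (@mkHom F N (ball_obj z k i) (ball_obj z k j)
  (fun w => @sub_map F _ _ _ _ (hom_lin (ball_map z k i j) w)
     (@ball_map_in z k i j w)) _).
by move=> w v h x; apply: val_inj; rewrite /= hom_nat.
Defined.

Lemma ball_diffE (z : grade N) k i j w x :
  val (ball_diff z k i j w x) = ball_map z k i j w (val x).
Proof. by []. Qed.

Definition ball (z : grade N) (k : int) : complex F N.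
Proof.
refine (@Complex F N (ball_obj z k) (ball_diff z k) _ _).
- move=> i j ij; apply: homP => w x; apply: val_inj; rewrite ball_diffE.
  rewrite /ball_map; case: ifP => [/andP[/eqP ik /eqP jk]|_] //.
  by rewrite ik jk eqxx in ij.
- move=> i j l; apply: homP => w x; apply: val_inj.
  rewrite hcompE !ball_diffE /ball_map.
  case: ifP => [/andP[/eqP jk _]|_] //; case: ifP => [/andP[_ /eqP jk']|_].
    by exfalso; lia.
  by rewrite hom0E linear0.
Defined.

Definition csum C D : complex F N.
Proof.
refine (@Complex F N (fun i => psum (C i) (D i))
  (fun i j => psum_hom (cdiff C i j) (cdiff D i j)) _ _).
- by move=> i j ij; rewrite !cdiff_shape //; apply: homP.
- move=> i j k; apply: homP => z x; congr (_, _); exact: cdiffK.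
Defined.

Definition ciso C D : Prop :=
  exists (f : forall i, Hom (C i) (D i)) (g : forall i, Hom (D i) (C i)),
    [/\ forall i j, hcomp (f j) (cdiff C i j) = hcomp (cdiff D i j) (f i),
        forall i j, hcomp (g j) (cdiff D i j) = hcomp (cdiff C i j) (g i),
        forall i, hcomp (g i) (f i) = hid (C i)
      & forall i, hcomp (f i) (g i) = hid (D i)].

Definition minimal C : Prop :=
  forall z k D, ~ ciso C (csum (ball z k) D).

(* G is concentrated in nonnegative degrees and, with an augmentation e,
   ... -> G_1 -> G_0 -> M -> 0 is exact. *)
Definition resolution G M : Prop :=
  (forall i, i < 0 -> forall z (x : G i z), x = 0) /\
  exists e : Hom (G 0) M,
    [/\ forall z (y : M z), exists x, e z x = y,
        forall z x, e z x = 0 <-> exists y, cdiff G 1 0 z y = x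
      & forall i, 0 < i -> forall z x, cdiff G i (i - 1) z x = 0 <->
          exists y, cdiff G (i + 1) i z y = x].

Definition min_free_resolution G M : Prop :=
  [/\ forall i, finite_free (G i), resolution G M & minimal G].

(* The sum over all degrees is finite when its finite partial sums are bounded. *)
Definition finite_total_rank C : Prop :=
  exists rk : int -> seq (grade N),
    (forall e, has_rank (C e) (rk e)) /\
    exists B : nat, forall s : seq int, uniq s ->
      (\sum_(e <- s) size (rk e) <= B)%N.

End Complexes.

(* Main.v *)
From Pilot Require Import Defs.
From mathcomp Require Import all_boot all_order all_algebra.
From mathcomp Require Import boolp zify.
Import Pilot.Defs.

Set Implicit Arguments.
Unset Strict Implicit.
Unset Printing Implicit Defensive.
Import Order.TTheory GRing.Theory Num.Theory.
Local Open Scope ring_scope.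

(** Write X for the complex hat C and w for a grade. A basis of every C_e turns
    the complexes at hand into matrices whose entries are nonzero only between
    comparable grades, so that every set of grades that is closed under taking
    intermediate grades defines a subquotient complex by masking rows and
    columns.

    Duality. The component at - w of the dual complex of X is the linear dual of
    the subquotient of X spanned by the basis elements that exceed w in all N
    coordinates, while the component of X at w is spanned by the basis elements
    that are at most w in all coordinates. Suppose that the homology of X
    vanishes at all grades that are not below some fixed grade. A subquotient of
    X given by bounds in only some of the coordinates is then acyclic
    ([box_exact]), because a coordinate without a bound can be given a very
    large upper bound. Turning the upper bounds into lower bounds one coordinate
    at a time therefore yields N connecting isomorphisms, each of degree one,
    and H_d(X) at w becomes the linear dual of H^(d+N)(X^dagger) at - w,
    naturally in w ([exists_link] together with [functional_cocyc] and
    [functional_cyc]). The isomorphism is handled as a relation between cycles,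
    composed of the N connecting relations, which avoids a choice of lifts.

    Resolutions. Let G be a minimal free resolution of M = H^(d+N)(X^dagger).
    The homology of G is M in degree 0, and M is nonzero only at grades below a
    fixed one, so the same duality applies to G: the cohomology of G^dagger is
    concentrated in degree N, where it is the pointwise dual of M, which is
    H_d(X) again. The section on transfer compares the two dualities through the
    augmentation of G and produces the augmentation of G[N]^dagger
    ([dual_resolution]). The complex G[N]^dagger has no negative degrees because
    G has length at most N; this is a Koszul argument ([syzygy]). Minimality
    means that no matrix entry between equal grades is nonzero
    ([minimal_no_units], [no_units_minimal]), a condition that is symmetric
    under transposition, so it passes to the dual.

    The complex hat C. At a grade that is not below zeta, some coordinate i
    exceeds that of zeta, the inclusions of P_S into P_(S minus i) are
    isomorphisms there, and they contract the total complex ([hat_exact]), so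
    that duality applies to X. At the grades below zeta only the summand with
    empty S survives, so X agrees with C there; since C is generated below zeta,
    R turns H_d(X) into H_d(C) ([R_homology_hat]). Finally R is exact, maps free
    modules to free modules and preserves the shape of the matrices
    ([R_min_resolution]). *)

(** * Graded matrices *)

Lemma zle_refl N (z : grade N) : zle z z.
Proof. exact/zleP. Qed.

Lemma zle_anti N (z w : grade N) : zle z w -> zle w z -> z = w.
Proof.
move=> /zleP zw /zleP wz; apply/ffunP => i; apply/eqP.
by rewrite eq_le zw wz.
Qed.

(** A complex of finite free modules in terms of bases: the boundary of a basis
    element only involves basis elements of smaller or equal grade. *)
Record gmat (F : fieldType) (N : nat) := Gmat {
  gn : int -> nat;
  gg : forall j, 'I_(gn j) -> grade N;
  gD : forall i j, 'M[F]_(gn i, gn j);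
  gD_shape : forall i j, i != j + 1 -> gD i j = 0;
  gD_sq : forall i j k, gD i j *m gD j k = 0;
  gD_graded : forall i j a b, gD i j a b != 0 -> zle (gg b) (gg a) }.

Section Masks.
Variables (F : fieldType) (N : nat) (X : gmat F N).
Implicit Types (P Q R S : grade N -> bool) (i j k : int).

Definition pi P j : 'M[F]_(gn X j) := diag_mx (\row_a (P (gg a))%:R).

Lemma piE P j m (x : 'M[F]_(m, gn X j)) r a :
  (x *m pi P j) r a = x r a *+ P (gg a).
Proof. by rewrite mul_mx_diag !mxE mulr_natr. Qed.

Lemma pi_lE P j m (x : 'M[F]_(gn X j, m)) r a :
  (pi P j *m x) a r = x a r *+ P (gg a).
Proof. by rewrite mul_diag_mx !mxE mulr_natl. Qed.

Lemma pi_pi P Q j : pi P j *m pi Q j = pi (fun z => P z && Q z) j.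
Proof.
apply/matrixP => a b; rewrite piE !mxE.
by case: (a =P b) => [->|_]; case: (P _); case: (Q _); rewrite ?mulr1n ?mulr0n ?mul0rn.
Qed.

Lemma eq_pi P Q j : P =1 Q -> pi P j = pi Q j.
Proof. by move=> PQ; apply/matrixP => a b; rewrite !mxE PQ. Qed.

Lemma pi_id P j : pi P j *m pi P j = pi P j.
Proof. by rewrite pi_pi; apply: eq_pi => z; rewrite andbb. Qed.

(** Only pairs of comparable grades matter for a masked boundary matrix; all
    comparisons between subquotients below are instances of this. *)
Lemma piDpi P Q R S i j :
  (forall z w, zle w z -> P z && Q w = R z && S w) ->
  pi P i *m gD X i j *m pi Q j = pi R i *m gD X i j *m pi S j.
Proof.
move=> H; apply/matrixP => a b; rewrite !piE !pi_lE -!mulrnA !mulnb.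
have [->|/gD_graded ba] := eqVneq (gD X i j a b) 0; first by rewrite !mul0rn.
by rewrite H.
Qed.

(* The boundary of the subquotient spanned by the basis elements with grade in
   P, which is a complex when P is convex. *)
Definition mD P i j := pi P i *m gD X i j *m pi P j.

Lemma mD_shape P i j : i != j + 1 -> mD P i j = 0.
Proof. by move=> ij; rewrite /mD gD_shape // mulmx0 mul0mx. Qed.

Lemma pi_mD P i j : pi P i *m mD P i j = mD P i j.
Proof. by rewrite /mD !mulmxA pi_id. Qed.

Lemma mD_pi P i j : mD P i j *m pi P j = mD P i j.
Proof. by rewrite /mD -!mulmxA pi_id. Qed.

Definition convex P :=
  forall z w v, zle w z -> zle v w -> P z -> P v -> P w.

Lemma mD_sq P i j k : convex P -> mD P i j *m mD P j k = 0.
Proof.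
move=> cP; rewrite /mD !mulmxA -(mulmxA _ (pi P j) (pi P j)) pi_id.
have -> : pi P i *m gD X i j *m pi P j *m gD X j k *m pi P k =
          pi P i *m (gD X i j *m gD X j k) *m pi P k.
  apply/matrixP => a c; rewrite !piE.
  case Pc: (P (gg c)); last by rewrite !mulr0n.
  rewrite !mulr1n mxE pi_lE mxE -sumrMnl; apply: eq_bigr => b _.
  rewrite piE pi_lE.
  have [->|/gD_graded ba] := eqVneq (gD X i j a b) 0.
    by rewrite !mul0rn !mul0r mul0rn.
  have [->|/gD_graded cb] := eqVneq (gD X j k b c) 0.
    by rewrite !mulr0 mul0rn.
  case Pa: (P (gg a)); last by rewrite mulr0n mul0rn mul0r.
  by rewrite (cP _ _ _ ba cb).
by rewrite gD_sq mulmx0 mul0mx.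
Qed.

Definition cyc P j (x : 'rV[F]_(gn X j)) : Prop :=
  x *m pi P j = x /\ forall k, x *m mD P j k = 0.

Definition bnd P j (x : 'rV[F]_(gn X j)) : Prop :=
  exists t : 'rV_(gn X (j + 1)), t *m mD P (j + 1) j = x.

Definition exact P j : Prop := forall x : 'rV_(gn X j), cyc P x -> bnd P x.

Lemma cyc_lin P j a (x y : 'rV_(gn X j)) :
  cyc P x -> cyc P y -> cyc P (a *: x + y).
Proof.
move=> [xP xD] [yP yD]; split=> [|k]; rewrite mulmxDl -scalemxAl ?xP ?yP //.
by rewrite xD yD scaler0 addr0.
Qed.

Lemma cycS P j (x : 'rV_(gn X (j + 1))) :
  x *m pi P _ = x -> x *m mD P (j + 1) j = 0 -> cyc P x.
Proof.
move=> xP xD; split=> // k; have [/addIr <- //|jk] := eqVneq (j + 1) (k + 1).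
by rewrite mD_shape // mulmx0.
Qed.

Lemma cycB P j (x : 'rV_(gn X j)) :
  x *m pi P j = x -> x *m mD P j (j - 1) = 0 -> cyc P x.
Proof.
move=> xP xD; split=> // k; have [e|jk] := eqVneq j (k + 1).
  by rewrite (_ : k = j - 1) // e addrK.
by rewrite mD_shape // mulmx0.
Qed.

Lemma bnd_cyc P j (x : 'rV_(gn X j)) : convex P -> bnd P x -> cyc P x.
Proof.
move=> cP [t <-]; split=> [|k]; first by rewrite -mulmxA mD_pi.
by rewrite -mulmxA mD_sq // mulmx0.
Qed.

Lemma bnd0 P j : bnd P (0 : 'rV_(gn X j)).
Proof. by exists 0; rewrite mul0mx. Qed.

(** Exactness in degree j only involves the basis elements of the three
    degrees around j, hence only finitely many grades. *)
Lemma exact_local P Q j :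
  (forall k, `|k - j| <= 1 -> forall a : 'I_(gn X k), P (gg a) = Q (gg a)) ->
  exact P j -> exact Q j.
Proof.
move=> PQ eP.
have pPQ k : `|k - j| <= 1 -> pi P k = pi Q k.
  by move=> kj; apply/matrixP => a b; rewrite !mxE PQ.
have mPQ i k : `|i - j| <= 1 -> `|k - j| <= 1 -> mD P i k = mD Q i k.
  by move=> ij kj; rewrite /mD !pPQ.
move=> x [xQ xD]; have [|t tx] := eP x.
  apply: cycB; first by rewrite pPQ // subrr normr0.
  by rewrite mPQ ?xD //; lia.
by exists t; rewrite -mPQ //; lia.
Qed.

End Masks.

(** * Connecting relations of short exact sequences *)

Section Connecting.
Variables (F : fieldType) (N : nat) (X : gmat F N).
Variables Q Q' P : grade N -> bool.
Hypothesis PE : forall z, P z = Q z || Q' z.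
Hypothesis QQ' : forall z w, zle w z -> Q z -> Q' w -> False.
Hypothesis cP : convex P.
(* Q spans a subcomplex of the complex given by P, with quotient given by Q'. *)

Lemma con_disj z : Q z -> Q' z -> False.
Proof. exact: QQ' (zle_refl z). Qed.

Lemma sub_mD i j : pi X Q i *m mD X P i j = mD X Q i j.
Proof.
rewrite /mD !mulmxA pi_pi; apply: piDpi => z w wz; rewrite !PE.
case Qz: (Q z) => //=; case Qw: (Q w) => //=.
by apply/negP => /(QQ' wz Qz).
Qed.

Lemma mD_quo i j : mD X P i j *m pi X Q' j = mD X Q' i j.
Proof.
rewrite /mD -!mulmxA pi_pi !mulmxA; apply: piDpi => z w wz; rewrite !PE.
case Q'w: (Q' w); rewrite ?andbF //= orbT !andbT.
by case Qz: (Q z) => //=; case: (QQ' wz Qz Q'w).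
Qed.

Lemma pi_sub j : pi X Q j *m pi X P j = pi X Q j.
Proof. by rewrite pi_pi; apply: eq_pi => z; rewrite PE; case: (Q z). Qed.

Lemma pi_quo j : pi X P j *m pi X Q' j = pi X Q' j.
Proof.
by rewrite pi_pi; apply: eq_pi => z; rewrite PE; case: (Q' z); rewrite ?orbT ?andbF.
Qed.

Lemma pi_quo' j : pi X Q' j *m pi X P j = pi X Q' j.
Proof.
by rewrite pi_pi; apply: eq_pi => z; rewrite PE; case: (Q' z); rewrite ?orbT ?andbF.
Qed.

Lemma pi_sub_quo j : pi X Q j *m pi X Q' j = 0.
Proof.
rewrite pi_pi; apply/matrixP => a b; rewrite !mxE.
case E: (_ && _); last by rewrite mul0rn.
by case/andP: E => /con_disj h /h.
Qed.

Lemma pi_split j : pi X P j = pi X Q j + pi X Q' j.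
Proof.
apply/matrixP => a b; rewrite !mxE PE -mulrnDl; congr (_ *+ _).
by case Qb: (Q _); case Q'b: (Q' _); rewrite ?addr0 ?add0r //;
  case: (con_disj Qb Q'b).
Qed.

(* The connecting homomorphism maps the class of y to that of x: t is a lift of
   the cycle y of the quotient, and its boundary x lies in the subcomplex. *)
Definition con j (x : 'rV[F]_(gn X j)) (y : 'rV[F]_(gn X (j + 1))) : Prop :=
  exists t, [/\ t *m pi X P _ = t, t *m pi X Q' _ = y,
                t *m mD X P (j + 1) j = x & x *m pi X Q _ = x].

Lemma con_cyc_l j (x : 'rV[F]_(gn X j)) y : con x y -> cyc Q x.
Proof.
move=> [t [_ _ tx xQ]]; split=> // k.
by rewrite -sub_mD mulmxA xQ -tx -mulmxA mD_sq // mulmx0.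
Qed.

Lemma con_cyc_r j (x : 'rV[F]_(gn X j)) y : con x y -> cyc Q' y.
Proof.
move=> [t [_ <- tx xQ]]; apply: cycS; first by rewrite -mulmxA pi_id.
by rewrite -mulmxA pi_mD -mD_quo mulmxA tx -xQ -mulmxA pi_sub_quo mulmx0.
Qed.

Lemma con_lin j a (x x' : 'rV[F]_(gn X j)) y y' :
  con x y -> con x' y' -> con (a *: x + x') (a *: y + y').
Proof.
move=> [t [t1 t2 t3 t4]] [s [s1 s2 s3 s4]]; exists (a *: t + s).
by rewrite !mulmxDl -!scalemxAl t1 t2 t3 t4 s1 s2 s3 s4.
Qed.

Lemma con_dom j (x : 'rV[F]_(gn X j)) :
  exact X P j -> cyc Q x -> exists y, con x y.
Proof.
move=> eP [xQ xD]; have [|t tx] := eP x.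
  split=> [|k]; first by rewrite -xQ -mulmxA pi_sub.
  by rewrite -xQ -mulmxA sub_mD.
exists (t *m pi X P _ *m pi X Q' _), (t *m pi X P _); split=> //.
  by rewrite -mulmxA pi_id.
by rewrite -mulmxA pi_mD.
Qed.

Lemma con_cod j (y : 'rV[F]_(gn X (j + 1))) :
  cyc Q' y -> exists x : 'rV_(gn X j), con x y.
Proof.
move=> [yQ yD]; exists (y *m mD X P (j + 1) j), y; split=> //.
  by rewrite -yQ -mulmxA pi_quo'.
have {2}-> : mD X P (j + 1) j = mD X P (j + 1) j *m pi X P j by rewrite mD_pi.
by rewrite pi_split mulmxDr mulmxDr mD_quo yD addr0 -!mulmxA.
Qed.

Lemma con_bnd_l j (x : 'rV[F]_(gn X j)) y :
  exact X P (j + 1) -> con x y -> bnd Q x -> bnd Q' y.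
Proof.
move=> eP [t [tP <- tx xQ]] [s sx].
have [|r rE] := eP (t - s *m pi X Q _).
  apply: cycS; first by rewrite mulmxBl tP -mulmxA pi_sub.
  by rewrite mulmxBl -mulmxA sub_mD sx tx subrr.
exists r; rewrite -mD_quo mulmxA rE mulmxBl -!mulmxA pi_sub_quo.
by rewrite !mulmx0 subr0.
Qed.

Lemma con_bnd_r j (x : 'rV[F]_(gn X j)) y :
  con x y -> bnd Q' y -> bnd Q x.
Proof.
move=> [t [tP ty tx xQ]] [s sy].
exists (t - s *m mD X P _ _); rewrite -sub_mD mulmxA.
suff -> : (t - s *m mD X P (j + 1 + 1) (j + 1)) *m pi X Q (j + 1) =
          t - s *m mD X P (j + 1 + 1) (j + 1).
  by rewrite mulmxBl -mulmxA mD_sq // mulmx0 subr0.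
have eu : (t - s *m mD X P (j + 1 + 1) (j + 1)) *m pi X P (j + 1) =
          t - s *m mD X P (j + 1 + 1) (j + 1).
  by rewrite mulmxBl tP -mulmxA mD_pi.
rewrite -{2}eu pi_split mulmxDr [X in _ = _ + X](_ : _ = 0) ?addr0 //.
by rewrite mulmxBl ty -mulmxA mD_quo sy subrr.
Qed.

(** The long exact homology sequence at the quotient. *)
Lemma exact_quo j : exact X P (j + 1) -> exact X Q j -> exact X Q' (j + 1).
Proof.
move=> eP eQ y /con_cod[x xy]; apply: (con_bnd_l eP xy).
by apply: eQ; apply: con_cyc_l xy.
Qed.

End Connecting.

(** * Boxes of grades *)

Section Boxes.
Variable N : nat.
Implicit Types (A B : {set 'I_N}) (w z : grade N).

Definition box A B w z : bool :=
  [forall i, (if i \in A then z i <= w i else true) &&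
             (if i \in B then w i < z i else true)].

Lemma boxP A B w z :
  reflect ((forall i, i \in A -> z i <= w i) /\ (forall i, i \in B -> w i < z i))
          (box A B w z).
Proof.
apply: (iffP forallP) => [H|[HA HB] i].
  by split=> i ii; have := H i; rewrite ii => /andP[].
by case: ifP => [/HA ->|_]; case: ifP => [/HB ->|_].
Qed.

Lemma box_convex A B w : convex (box A B w).
Proof.
move=> z v u /zleP vz /zleP uv /boxP[zA zB] /boxP[uA uB].
by apply/boxP; split=> i ii; [apply: le_trans (vz i) (zA i ii) |
  apply: lt_le_trans (uB i ii) (uv i)].
Qed.

Lemma box_split A B w i z :
  box A B w z = box (i |: A) B w z || box A (i |: B) w z.
Proof.
apply/boxP/orP => [[zA zB]|].
  have [zi|zi] := lerP (z i) (w i); [left|right]; apply/boxP; split=> //.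
  - by move=> k /setU1P[->//|]; apply: zA.
  - by move=> k /setU1P[->//|]; apply: zB.
by case=> /boxP[zA zB]; split=> k kk;
  first [apply: zA | apply: zB]; rewrite ?in_setU1 ?kk ?orbT.
Qed.

Lemma box_disj A B w i z v :
  zle v z -> box (i |: A) B w z -> box A (i |: B) w v -> False.
Proof.
move=> /zleP vz /boxP[zA _] /boxP[_ vB].
have := vB i (setU11 _ _); have := zA i (setU11 _ _); have := vz i.
by move=> h1 h2; rewrite ltNge (le_trans h1 h2).
Qed.

End Boxes.

Section BoxExact.
Variables (F : fieldType) (N : nat) (X : gmat F N) (b : grade N).
Hypothesis Xb : forall w, ~~ zle w b -> forall j, exact X (fun z => zle z w) j.

Lemma grades_bounded j : exists m : int,
  0 <= m /\ forall k, `|k - j| <= 1 -> forall (a : 'I_(gn X k)) i, gg a i <= m.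
Proof.
pose m k : int := \sum_(a : 'I_(gn X k)) \sum_i `|gg a i|.
have m0 k : 0 <= m k by apply: sumr_ge0 => a _; apply: sumr_ge0.
have mE k a i : @gg _ _ X k a i <= m k.
  rewrite (le_trans (ler_norm _)) // /m (bigD1 a) //= (bigD1 i) //= -addrA.
  rewrite lerDl addr_ge0 // ?sumr_ge0 // => c _; exact: sumr_ge0.
exists (m (j - 1) + m j + m (j + 1)); split; first by rewrite !addr_ge0.
move=> k kj a i; apply: le_trans (mE k a i) _.
have := m0 (j - 1); have := m0 j; have := m0 (j + 1).
have [->|->|->] : [\/ k = j - 1, k = j | k = j + 1].
- case: (ltrgtP k j) => h; [apply: Or31 | apply: Or33 | apply: Or32]; lia.
all: by lia.
Qed.

(** If some coordinate i is unconstrained from above, the box can be cut off at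
    a large value of that coordinate, and then it is a lower set outside the
    support of the homology. Lower bounds are introduced one coordinate at a
    time by the long exact sequence. *)
Lemma box_exact A B w j : A :|: B != setT -> exact X (box A B w) j.
Proof.
move En: #|B| => n; elim: n B En A w j => [|n IHn] B cB A w j AB.
  have B0 : B = set0 by apply: cards0_eq.
  have [i iA] : exists i, i \notin A.
    move: AB; rewrite B0 setU0 -subTset => /subsetPn[i _ iA]; by exists i.
  have [m [m0 mP]] := grades_bounded j.
  (* The value m + `|b k| + 1 exceeds all grades in the three degrees as well as
     the coordinate of b. *)
  pose w' : grade N := [ffun k => if k \in A then w k else m + `|b k| + 1].
  apply: (@exact_local _ _ X (fun z => zle z w')); last first.
    apply: Xb; apply/negP => /zleP/(_ i); rewrite ffunE (negPf iA).
    by have := ler_norm (b i); lia.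
  move=> k kj a; rewrite B0; apply/zleP/boxP => [aw|[aA _] c].
    by split=> c; rewrite ?inE // => cA; have := aw c; rewrite ffunE cA.
  rewrite ffunE; case: ifP => [/aA//|_].
  by have := mP k kj a c; have := normr_ge0 (b c); lia.
have [i iB] : exists i, i \in B by apply/set0Pn; rewrite -card_gt0 cB.
have -> : B = i |: (B :\ i) by rewrite setD1K.
have cB' : #|B :\ i| = n by have := cardsD1 i B; rewrite iB cB add1n => -[].
rewrite -[j](subrK 1).
apply: (@exact_quo _ _ X (box (i |: A) (B :\ i) w) _ (box A (B :\ i) w)).
- exact: box_split.
- exact: box_disj.
- exact: box_convex.
- apply: IHn => //; apply: contra AB => /eqP e; rewrite -subTset -e.
  by rewrite setUS // subsetDl.
- apply: IHn => //; apply: contra AB => /eqP <-; apply/eqP/setP => k.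
  by rewrite !inE; case: (k =P i) => [->|]; rewrite ?iB ?orbT.
Qed.

End BoxExact.

(** * From the small elements to the large ones *)

Section Chain.
Variables (F : fieldType) (N : nat) (X : gmat F N).
Implicit Types (w v z : grade N) (m : nat).

(* The m-th box of the chain that leads from the elements below w to those
   that exceed w in all coordinates. *)
Definition stage m w : grade N -> bool :=
  box [set i : 'I_N | (m <= i)%N] [set i : 'I_N | (i < m)%N] w.
(* The stages m and m + 1 together: coordinate m is free. *)
Definition joint m w : grade N -> bool :=
  box [set i : 'I_N | (m < i)%N] [set i : 'I_N | (i < m)%N] w.

Lemma stageP m w z : reflect
  (forall i : 'I_N, if (i < m)%N then w i < z i else z i <= w i) (stage m w z).
Proof.
apply: (iffP (boxP _ _ _ _)) => [[h1 h2] i|h].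
  by case: ltnP => im; [apply: h2 | apply: h1]; rewrite inE.
split=> i; rewrite inE => im; have := h i; last by rewrite im.
by rewrite ltnNge im.
Qed.

Lemma joint_split m w z : (m < N)%N ->
  joint m w z = stage m w z || stage m.+1 w z.
Proof.
move=> mN; rewrite /joint (box_split _ _ _ (Ordinal mN)); congr (_ || _).
  congr box; apply/setP => i; rewrite !inE -val_eqE /=; lia.
congr box; apply/setP => i; rewrite !inE -val_eqE /= ; lia.
Qed.

Lemma stage_disj m w z v : (m < N)%N ->
  zle v z -> stage m w z -> stage m.+1 w v -> False.
Proof.
move=> mN /zleP/(_ (Ordinal mN)) vz /stageP/(_ (Ordinal mN)) + /stageP/(_ (Ordinal mN)).
rewrite /= ltnn ltnSn; lia.
Qed.

Definition low w z := zle z w.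
Definition high w z := [forall i, w i < z i].

Lemma stage0 w : stage 0 w = low w.
Proof.
by apply: funext => z; apply/stageP/zleP => h i; have := h i; rewrite ltn0.
Qed.

Lemma stageN w : stage N w = high w.
Proof.
by apply: funext => z; apply/stageP/forallP => h i; have := h i; rewrite ltn_ord.
Qed.

(* Iterating the successor makes the degree after m.+1 steps convertible to the
   degree after m steps plus one. *)
Definition deg j m : int := iter m (fun i => i + 1) j.

Lemma degE j m : deg j m = j + m%:Z.
Proof.
elim: m => [|m IHm]; first by rewrite addr0.
by rewrite /= -/(deg j m) IHm; lia.
Qed.

Definition step w m : forall j, 'rV[F]_(gn X j) -> 'rV[F]_(gn X (j + 1)) -> Prop :=
  @con F N X (stage m w) (stage m.+1 w) (joint m w).

Fixpoint chain w j m : 'rV[F]_(gn X j) -> 'rV[F]_(gn X (deg j m)) -> Prop :=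
  match m with
  | 0 => fun x y => x = y /\ cyc (stage 0 w) x
  | m'.+1 => fun x y => exists2 y', chain w x y' & step w m' y' y
  end.

Section Fixed.
Variables (w : grade N) (j : int).
Hypothesis Xex : forall m, (m < N)%N -> forall k, exact X (joint m w) k.

Lemma chain_cyc_r m x y : (m <= N)%N -> @chain w j m x y -> cyc (stage m w) y.
Proof.
case: m y => [|m] y mN; first by case=> <-.
case=> y' _; apply: con_cyc_r => [z|z v]; first exact: joint_split.
exact: stage_disj.
Qed.

Lemma chain_cyc_l m x y : @chain w j m x y -> cyc (stage 0 w) x.
Proof.
elim: m y => [|m IHm] y; first by case.
by case=> y' /IHm.
Qed.

Lemma chain_lin m a x x' y y' : @chain w j m x y -> chain w x' y' ->
  chain w (a *: x + x') (a *: y + y').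
Proof.
elim: m y y' => [|m IHm] y y'.
  by move=> [-> cy] [-> cy']; split=> //; apply: cyc_lin.
move=> [u xu uy] [u' xu' uy']; exists (a *: u + u'); first exact: IHm.
exact: con_lin.
Qed.

Lemma chain_dom m (x : 'rV_(gn X j)) : (m <= N)%N -> cyc (stage 0 w) x ->
  exists y : 'rV_(gn X (deg j m)), chain w x y.
Proof.
move=> + cx; elim: m => [|m IHm] mN; first by exists x.
have [y xy] := IHm (ltnW mN).
have [||y' yy'] := @con_dom F N X (stage m w) (stage m.+1 w) (joint m w) _ _ _ y
  (@Xex m mN _) (chain_cyc_r (ltnW mN) xy).
- by move=> z; apply: joint_split.
- by move=> z v; apply: stage_disj.
by exists y', y.
Qed.

Lemma chain_cod m (y : 'rV_(gn X (deg j m))) : (m <= N)%N ->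
  cyc (stage m w) y -> exists x : 'rV_(gn X j), chain w x y.
Proof.
elim: m y => [|m IHm] y mN cy; first by exists y.
have [||y' y'y] := @con_cod F N X (stage m w) (stage m.+1 w) (joint m w) _ _ _ y cy.
- by move=> z; apply: joint_split.
- by move=> z v; apply: stage_disj.
have [|x xy'] := IHm y' (ltnW mN).
  apply: con_cyc_l y'y => [z|z v|]; first exact: joint_split.
    exact: stage_disj.
  exact: box_convex.
by exists x, y'.
Qed.

Lemma chain_bnd m x y : (m <= N)%N -> @chain w j m x y ->
  bnd (stage 0 w) x <-> bnd (stage m w) y.
Proof.
elim: m y => [|m IHm] y mN; first by case=> ->.
case=> y' /(IHm _ (ltnW mN)) -> y'y; split.
  apply: con_bnd_l (@Xex m mN _) y'y => [z|z v]; first exact: joint_split.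
  exact: stage_disj.
apply: con_bnd_r y'y => [z|z v|]; first exact: joint_split.
  exact: stage_disj.
exact: box_convex.
Qed.

End Fixed.

Lemma jointP m w z : reflect (forall i : 'I_N,
    ((m < i)%N -> z i <= w i) /\ ((i < m)%N -> w i < z i)) (joint m w z).
Proof.
apply: (iffP (boxP _ _ _ _)) => [[h1 h2] i|h].
  by split=> im; [apply: h1 | apply: h2]; rewrite inE.
by split=> i; rewrite inE; have [h1 h2] := h i.
Qed.

Lemma joint_low w v m z u : zle v w -> zle u z ->
  joint m v z -> joint m w u -> joint m w z /\ joint m v u.
Proof.
move=> /zleP vw /zleP uz /jointP zv /jointP uw; split; apply/jointP => i.
  by move: (vw i) (uz i) (zv i) (uw i); lia.
by move: (vw i) (uz i) (zv i) (uw i); lia.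
Qed.

Lemma joint_stage w v m z : zle v w -> stage m v z -> joint m w z -> stage m w z.
Proof.
move=> /zleP vw /stageP zv /jointP zw; apply/stageP => i.
by move: (vw i) (zv i) (zw i); case: ltngtP; lia.
Qed.

Lemma joint_stageS w v m z : (m < N)%N -> zle v w ->
  joint m v z -> stage m.+1 w z -> stage m.+1 v z.
Proof.
move=> mN /zleP vw /jointP zv /stageP zw; apply/stageP => i.
by move: (vw i) (zv i) (zw i); rewrite ltnS; case: (ltngtP i m); lia.
Qed.

(** For v below w, masking is a chain map from each stage at v to the same
    stage at w: the elements that it kills span a subcomplex of the former, and
    the others span a subcomplex of the latter. *)
Lemma step_nat w v m j (x : 'rV[F]_(gn X j)) y : (m < N)%N -> zle v w ->
  step v m x y -> step w m (x *m pi X (stage m w) _) (y *m pi X (stage m.+1 w) _).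
Proof.
move=> mN vw [t [tP ty tx xQ]]; exists (t *m pi X (joint m w) _).
have jS u z : stage m.+1 u z -> joint m u z.
  by rewrite joint_split // => ->; rewrite orbT.
have js u z : stage m u z -> joint m u z by rewrite joint_split // => ->.
split.
- by rewrite -mulmxA pi_id.
- rewrite -ty -tP -!mulmxA !pi_pi; congr (_ *m _); apply: eq_pi => z.
  apply/and3P/and3P => -[h1 h2 h3]; split=> //; last exact: jS.
  exact: joint_stageS h1 h3.
- have E : pi X (joint m v) (j + 1) *m pi X (joint m w) _ *m mD X (joint m w) _ j =
           mD X (joint m v) _ j *m pi X (joint m w) _.
    rewrite /mD !mulmxA -(mulmxA (pi _ _ _) (pi _ _ _)) pi_id !pi_pi.
    rewrite -!mulmxA pi_pi !mulmxA; apply: piDpi => z u uz.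
    apply/andP/and3P => [[/andP[h1 h2] h3]|[h1 h2 h3]].
      by split=> //; have [] := joint_low vw uz h1 h3.
    by split=> //; rewrite h1; have [] := joint_low vw uz h1 h3.
  rewrite -tP -!mulmxA (mulmxA (pi _ _ _)) E mulmxA tx -xQ.
  rewrite -!mulmxA !pi_pi; congr (_ *m _); apply: eq_pi => z.
  by apply/andP/andP => -[h1 h2]; split=> //; [exact: joint_stage h1 h2|exact: js].
- by rewrite -mulmxA pi_id.
Qed.

Lemma chain_nat w v m j (x : 'rV[F]_(gn X j)) y : (m <= N)%N -> zle v w ->
  chain v x y -> chain w x (y *m pi X (stage m w) (deg j m)).
Proof.
move=> + vw; elim: m y => [|m IHm] y mN /=.
  case=> <- [xc xD].
  have xw : x *m pi X (stage 0 w) j = x.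
    rewrite -xc -mulmxA pi_pi; congr (_ *m _); apply: eq_pi => z.
    by rewrite !stage0 /low; case E: (zle z v) => //=; apply: zle_trans E vw.
  rewrite xw; split=> //; split=> // k.
  rewrite /mD !mulmxA xw -xc -!mulmxA (mulmxA (pi _ _ _)).
  rewrite (@piDpi _ _ _ _ _ (stage 0 v) (stage 0 v)); last first.
    move=> z u uz; rewrite !stage0 /low; case E: (zle z v) => //=.
    by rewrite (zle_trans uz E) (zle_trans uz (zle_trans E vw)).
  by rewrite -/(mD _ _ _ _) xD.
case=> y' /(IHm _ (ltnW mN)) xy' y'y; exists (y' *m pi X (stage m w) _) => //.
exact: (step_nat mN vw y'y).
Qed.

End Chain.

(** The relation between cycles given by an isomorphism, for each grade w,
    from the homology of the elements below w in degree j to that of the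
    elements exceeding w in all coordinates in degree k. *)
Record link (F : fieldType) (N : nat) (X : gmat F N) (j k : int)
    (r : grade N -> 'rV[F]_(gn X j) -> 'rV[F]_(gn X k) -> Prop) : Prop := Link {
  link_l : forall w x y, r w x y -> cyc (low w) x;
  link_r : forall w x y, r w x y -> cyc (high w) y;
  link_lin : forall w a x x' y y',
    r w x y -> r w x' y' -> r w (a *: x + x') (a *: y + y');
  link_dom : forall w x, cyc (low w) x -> exists y, r w x y;
  link_cod : forall w y, cyc (high w) y -> exists x, r w x y;
  link_bnd : forall w x y, r w x y -> bnd (low w) x <-> bnd (high w) y;
  link_nat : forall v w x y, zle v w -> r v x y -> r w x (y *m pi X (high w) _) }.

Lemma exists_link (F : fieldType) (N : nat) (X : gmat F N) (b : grade N) j k :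
  (forall w, ~~ zle w b -> forall i, exact X (low w) i) -> k = j + N%:Z ->
  exists r, @link F N X j k r.
Proof.
move=> Xb ->; rewrite -degE.
have ex w m : (m < N)%N -> forall i, exact X (joint m w) i.
  move=> mN i; apply: (box_exact Xb); apply/eqP => /setP/(_ (Ordinal mN)).
  by rewrite !inE /= ltnn.
exists (fun w x y => chain w x y); split=> w.
- by move=> x y /chain_cyc_l; rewrite stage0.
- by move=> x y /chain_cyc_r; rewrite stageN; apply.
- exact: chain_lin.
- by move=> x xc; apply: (chain_dom (ex w)); rewrite ?stage0.
- by move=> y yc; apply: chain_cod; rewrite ?stageN.
- by move=> x y /(chain_bnd (ex w)); rewrite stage0 stageN; apply.
- by move=> v x y wv /(chain_nat (leqnn N) wv); rewrite stageN.
Qed.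

(** * The length of minimal resolutions *)

Section Syzygy.
Variables (F : fieldType) (N : nat) (X : gmat F N).
Hypothesis Xex : forall w j, 0 < j -> exact X (low w) j.
Hypothesis Xmin : forall i j (a : 'I_(gn X i)) (b : 'I_(gn X j)),
  gg a = gg b -> gD X i j a b = 0.
Implicit Types (B : {set 'I_N}) (z w u : grade N).

Definition face B z u := zle u z && [forall i in B, u i == z i].

Lemma faceP B z u :
  reflect (zle u z /\ forall i, i \in B -> u i = z i) (face B z u).
Proof.
apply: (iffP andP) => [[uz /forall_inP h]|[uz h]]; split=> //.
  by move=> i /h/eqP.
by apply/forall_inP => i /h ->.
Qed.

Lemma face_convex B z : convex (face B z).
Proof.
move=> u v w vu wv /faceP[uz uB] /faceP[wz wB]; apply/faceP.
split=> [|i iB]; first exact: zle_trans vu uz.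
apply/eqP; rewrite eq_le -{1}(uB _ iB) -(wB _ iB).
by move/zleP: vu => ->; move/zleP: wv => ->.
Qed.

(** Each long exact sequence that fixes one more coordinate shifts the range of
    vanishing homology by one degree, as in the Koszul complex. *)
Lemma face_exact B z j : #|B|%:Z < j -> exact X (face B z) j.
Proof.
move En: #|B| => n; elim: n B En z j => [|n IHn] B cB z j jn.
  have -> : face B z = low z.
    apply: funext => u; rewrite /face (cards0_eq cB) andbC.
    by case: forall_inP => // -[] i; rewrite inE.
  exact: Xex.
have [i iB] : exists i, i \in B by apply/set0Pn; rewrite -card_gt0 cB.
have -> : B = i |: (B :\ i) by rewrite setD1K.
set B' := B :\ i.
have cB' : #|B'| = n by have := cardsD1 i B; rewrite iB cB add1n => -[].
have iB' : i \notin B' by rewrite !inE eqxx.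
pose z' : grade N := [ffun k => if k == i then z k - 1 else z k].
have z'z : zle z' z by apply/zleP => k; rewrite ffunE; case: ifP => // _; lia.
rewrite -[j](subrK 1); apply: (@exact_quo _ _ X (face B' z') _ (face B' z)).
- move=> u; apply/faceP/orP => [[uz uB]|].
    have [ui|ui] := eqVneq (u i) (z i); [right|left]; apply/faceP; split=> //.
    + by move=> k /setU1P[->|/uB].
    + apply/zleP => k; rewrite ffunE; move/zleP: uz => /(_ k).
      by case: eqP => // ->; move: ui; lia.
    + move=> k kB; rewrite ffunE ifN ?uB //.
      by apply: contraNneq iB' => <-.
  case=> /faceP[uz uB]; split=> //; first exact: zle_trans uz z'z.
  + move=> k kB; rewrite uB // ffunE ifN //.
    by apply: contraNneq iB' => <-.
  + by move=> k kB; rewrite uB // in_setU1 kB orbT.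
- move=> u w /zleP wu /faceP[/zleP uz _] /faceP[_ /(_ i (setU11 _ _)) wi].
  by have := wu i; have := uz i; rewrite ffunE eqxx wi; lia.
- exact: face_convex.
- by apply: IHn => //; lia.
- by apply: IHn => //; lia.
Qed.

(** With all coordinates fixed, minimality kills the boundary, so the basis
    elements of grade z themselves are the homology. *)
Lemma syzygy j : N%:Z < j -> gn X j = 0%N.
Proof.
move=> Nj; apply/eqP; rewrite -leqn0 leqNgt; apply/negP => n0.
pose a : 'I_(gn X j) := Ordinal n0.
have md i k : mD X (face setT (gg a)) i k = 0.
  apply/matrixP => r s; rewrite piE pi_lE mxE -mulrnA mulnb.
  case: andP => [|_]; last by rewrite mulr0n.
  move=> [/faceP[_ rE] /faceP[_ sE]]; rewrite Xmin ?mul0rn //.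
  by apply/ffunP => c; rewrite rE ?sE ?inE.
have [||t] := @face_exact setT (gg a) j _ (delta_mx 0 a).
- by rewrite cardsT card_ord.
- split=> [|k]; last by rewrite md mulmx0.
  apply/matrixP => r s; rewrite piE mxE.
  have [<-|] := eqVneq s a; last by rewrite andbF mul0rn.
  suff -> : face setT (gg s) (gg s) by [].
  by apply/faceP; split=> //; apply: zle_refl.
rewrite md mulmx0 => /matrixP/(_ 0 a); rewrite !mxE !eqxx => /eqP.
by rewrite eq_sym oner_eq0.
Qed.

End Syzygy.

(** * Morphisms given by their graphs *)

Section Graphs.
Variables (F : fieldType) (N : nat).
Implicit Types (M L : pmod F N).

(** A morphism can be given by a graph that is only known to be functional. *)
Lemma hom_of_rel M L (R : forall z, M z -> L z -> Prop) :
  (forall z a x x' y y', R z x y -> R z x' y' -> R z (a *: x + x') (a *: y + y')) ->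
  (forall z x, exists y, R z x y) ->
  (forall z y, R z 0 y -> y = 0) ->
  (forall z w (h : zle z w) x y, R z x y -> R w (pmap M h x) (pmap L h y)) ->
  exists f : Hom M L, forall z x y, R z x y <-> f z x = y.
Proof.
move=> Rlin Rtot R0 Rnat.
have Runiq z x y y' : R z x y -> R z x y' -> y = y'.
  move=> xy xy'; apply/eqP; rewrite -subr_eq0; apply/eqP/(R0 z).
  by have := Rlin _ (-1) _ _ _ _ xy' xy; rewrite !scaleN1r addNr addrC.
pose f z x := sval (cid (Rtot z x)).
have fR z x : R z x (f z x) by rewrite /f; case: cid.
have fl z : linear (f z).
  by move=> a x y; apply: (Runiq z) (fR _ _) (Rlin _ _ _ _ _ _ (fR _ _) (fR _ _)).
have fn z w (h : zle z w) x : f w (pmap M h x) = pmap L h (f z x).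
  by apply: (Runiq w) (fR _ _) (Rnat _ _ _ _ _ (fR _ _)).
exists (@mkHom F N M L (fun z => mkLin (fl z)) fn) => z x y; split=> [xy|<-].
  exact: Runiq (fR z x) xy.
exact: fR.
Qed.

Lemma hom_inj0 M L (f : Hom M L) : (forall z x, f z x = 0 -> x = 0) ->
  forall z, injective (f z).
Proof.
move=> f0 z x y xy; apply/eqP; rewrite -subr_eq0; apply/eqP/(f0 z).
by rewrite (linearB (hom_lin f z)) /= xy subrr.
Qed.

Lemma piso_of_bij M L (f : Hom M L) :
  (forall z x, f z x = 0 -> x = 0) -> (forall z y, exists x, f z x = y) ->
  piso M L.
Proof.
move=> /hom_inj0 finj fsurj.
have [|||z w h y x <-|g gP] := @hom_of_rel L M (fun z y x => f z x = y).
- by move=> z a x x' y y' <- <-; rewrite hom_linear.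
- exact: fsurj.
- by move=> z y y0; apply: (finj z); rewrite y0 linear0.
- by rewrite hom_nat.
exists f, g; split; apply: homP => z x; rewrite hcompE /=; first exact/gP.
exact/gP.
Qed.

End Graphs.

(** * Bases of free modules *)

Section Basis.
Variables (F : fieldType) (N : nat).
Implicit Types (M L : pmod F N) (w z : grade N).

(** Coordinates, instead of an isomorphism with a standard free module: the
    constructions applied to free modules below then only change the index set
    and the grades. *)
Record basis M := Basis {
  bidx : finType;
  bgr : bidx -> grade N;
  co : forall w, M w -> bidx -> F;
  co_lin : forall w a (x y : M w) i, co (a *: x + y) i = a * co x i + co y i;
  co_nat : forall z w (h : zle z w) (x : M z) i, co (pmap M h x) i = co x i;
  co_inj : forall w (x y : M w), (forall i, co x i = co y i) -> x = y;
  co_supp : forall w (x : M w) i, co x i != 0 -> zle (bgr i) w;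
  co_surj : forall w (f : bidx -> F), (forall i, f i != 0 -> zle (bgr i) w) ->
    exists x : M w, forall i, co x i = f i }.

Arguments co {M} b {w} x i : rename.
Arguments co_lin {M} b {w} a x y i : rename.
Arguments co_nat {M} b {z w} h x i : rename.
Arguments co_inj {M} b {w x y} _ : rename.
Arguments co_surj {M} b {w f} _ : rename.

Lemma basis_rank M Q : has_rank M Q ->
  exists b : basis M, forall i, bgr (b := b) i \in Q.
Proof.
move=> [f [g [gf fg]]].
have fl w : linear (hom_at f w) by move=> a x y; apply: hom_linear.
pose c w (x : M w) (i : 'I_(size Q)) : F := val (f w x i).
unshelve eexists.
  refine (@Basis M _ (fun i : 'I_(size Q) => nth 0 Q i) c _ _ _ _ _).
- by move=> w a x y i; rewrite /c fl.
- by move=> z w h x i; rewrite /c hom_nat.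
- move=> w x y xy; have gfE u : g w (f w u) = u.
    by rewrite -hcompE gf.
  rewrite -[x]gfE -[y]gfE; congr (g w _); apply: functional_extensionality_dep => i.
  by apply: val_inj; apply: xy.
- move=> w x i; apply: contraNT => n.
  by apply/eqP; exact: (subm_in (f w x i) n).
- move=> w h hs.
  have P (i : 'I_(size Q)) : if_submod (pconst F N w) (zle (nth 0 Q i) w) (h i).
    move=> /= n; apply: contraNeq n; exact: hs.
  exists (g w ((fun i => mkSub (P i)) : pfree F Q w)) => i.
  by rewrite /c -hcompE fg.
by move=> i /=; apply: mem_nth.
Qed.


Lemma basis_finite_free M : basis M -> finite_free M.
Proof.
case=> I g c clin cnat cinj csupp csurj.
pose Q := [seq g i | i <- enum I]; exists Q.
have sQ : size Q = #|I| by rewrite size_map cardE.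
pose t (i : 'I_(size Q)) : I := enum_val (cast_ord sQ i).
have tE (i : 'I_(size Q)) : nth 0 Q i = g (t i).
  rewrite /t /enum_val (nth_map (enum_default (cast_ord sQ i))) //.
  by rewrite -cardE -sQ.
have P z (x : M z) (i : 'I_(size Q)) :
    if_submod (pconst F N z) (zle (nth 0 Q i) z) (c z x (t i)).
  by move=> /= n; apply: contraNeq n; rewrite tE; apply: csupp.
have fl z : linear (fun x : M z => (fun i => mkSub (P z x i)) : pfree F Q z).
  move=> a x y; apply: functional_extensionality_dep => i.
  by apply: val_inj => /=; rewrite clin.
have fn z w (h : zle z w) x : mkLin (fl w) (pmap M h x) =
    pmap (pfree F Q) h (mkLin (fl z) x).
  apply: functional_extensionality_dep => i.
  by apply: val_inj => /=; rewrite cnat.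
apply: (@piso_of_bij _ _ M (pfree F Q) (mkHom fn)) => z.
  move=> x x0; apply: cinj => i; have c0 : c z 0 i = 0.
    by have := clin z (-1) 0 0 i; rewrite scaler0 addr0 mulN1r addNr.
  have := congr1 (fun y : pfree F Q z => val (y (cast_ord (esym sQ) (enum_rank i)))) x0.
  by rewrite c0 /= /t cast_ordKV enum_rankK.
move=> y; pose h i : F := val (y (cast_ord (esym sQ) (enum_rank i))).
have hs i : h i != 0 -> zle (g i) z.
  apply: contraNT => n; apply/eqP.
  apply: (subm_in (y (cast_ord (esym sQ) (enum_rank i)))).
  by rewrite tE /t cast_ordKV enum_rankK.
have [x xy] := csurj z h hs; exists x.
apply: functional_extensionality_dep => i; apply: val_inj => /=.
by rewrite xy /h /t enum_valK cast_ordK.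
Qed.

End Basis.

Arguments co {F N M} b {w} x i : rename.
Arguments co_lin {F N M} b {w} a x y i : rename.
Arguments co_nat {F N M} b {z w} h x i : rename.
Arguments co_inj {F N M} b {w x y} _ : rename.
Arguments co_surj {F N M} b {w f} _ : rename.

Section BasisVectors.
Variables (F : fieldType) (N : nat) (M : pmod F N) (b : basis M).
Implicit Types (w z : grade N).
Notation I := (bidx b).

Lemma co0 w i : co b (0 : M w) i = 0.
Proof. by have := co_lin b (-1) (0 : M w) 0 i; rewrite scaler0 addr0 mulN1r addNr. Qed.

Lemma coZ w a (x : M w) i : co b (a *: x) i = a * co b x i.
Proof. by rewrite -[_ *: x]addr0 co_lin co0 addr0. Qed.

Lemma coD w (x y : M w) i : co b (x + y) i = co b x i + co b y i.
Proof. by rewrite -[x]scale1r co_lin mul1r scale1r. Qed.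

Lemma co_sum w (J : finType) (x : J -> M w) i :
  co b (\sum_k x k) i = \sum_k co b (x k) i.
Proof.
by apply: (big_morph (fun y : M w => co b y i)); [move=> y z; apply: coD | apply: co0].
Qed.

Fact bv_supp w (i : I) k : ((k == i) && zle (bgr i) w)%:R != 0 :> F -> zle (bgr k) w.
Proof. by have [->|_] := eqVneq k i; [case: (zle _ _); rewrite ?eqxx|rewrite eqxx]. Qed.

(* The basis vector with index i, pushed to grade w; it is 0 where that basis
   vector does not exist yet. *)
Definition bv w (i : I) : M w := sval (cid (co_surj b (@bv_supp w i))).

Lemma co_bv w i k : co b (bv w i) k = ((k == i) && zle (bgr i) w)%:R.
Proof. by rewrite /bv; case: cid => x xE; exact: xE. Qed.

Lemma bv_sum w (x : M w) : x = \sum_i co b x i *: bv w i.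
Proof.
apply: (co_inj b) => k; rewrite co_sum (bigD1 k) //= big1 => [|i ik].
  rewrite addr0 coZ co_bv eqxx /=.
  have [->|/co_supp ->] := eqVneq (co b x k) 0; first by rewrite mul0r.
  by rewrite mulr1.
by rewrite coZ co_bv eq_sym (negPf ik) mulr0.
Qed.

Lemma pmap_bv z w (h : zle z w) i : zle (bgr i) z -> pmap M h (bv z i) = bv w i.
Proof.
move=> iz; apply: (co_inj b) => k.
by rewrite co_nat !co_bv iz (zle_trans iz h).
Qed.

Lemma hom_bv (L : pmod F N) (f : Hom M L) w (x : M w) (c : L w -> F) :
  (forall a y y', c (a *: y + y') = a * c y + c y') ->
  c (f w x) = \sum_i co b x i * c (f w (bv w i)).
Proof.
move=> cl; have c0 : c 0 = 0.
  by have := cl (-1) 0 0; rewrite scaler0 addr0 mulN1r addNr.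
have cD y y' : c (y + y') = c y + c y' by rewrite -[y]scale1r cl mul1r scale1r.
have cZ a y : c (a *: y) = a * c y by rewrite -[_ *: y]addr0 cl c0 addr0.
rewrite {1}[x]bv_sum (linear_sum (hom_lin f w)) /= (big_morph c cD c0).
by apply: eq_bigr => i _; rewrite (linearZ_LR (hom_lin f w)) /= cZ.
Qed.

End BasisVectors.

Arguments bv {F N M} b w i : rename.

(* Matrix entries of f; each basis vector is evaluated at its own grade. *)
Definition hmx F N (M L : pmod F N) (bM : basis M) (bL : basis L) (f : Hom M L)
  (i : bidx bM) (k : bidx bL) : F := co bL (f (bgr i) (bv bM (bgr i) i)) k.
Arguments hmx {F N M L} bM bL f i k.

Lemma hmxE F N (M L : pmod F N) (bM : basis M) (bL : basis L) (f : Hom M L) w x k :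
  co bL (f w x) k = \sum_i co bM x i * hmx bM bL f i k.
Proof.
rewrite (hom_bv bM f x (c := fun y => co bL y k)); last by move=> a y y'; apply: co_lin.
apply: eq_bigr => i _; have [->|/co_supp iw] := eqVneq (co bM x i) 0.
  by rewrite !mul0r.
by rewrite -(pmap_bv (b := bM) iw) ?zle_refl // hom_nat co_nat.
Qed.

Section DualBasis.
Variables (F : fieldType) (N : nat) (M : pmod F N) (b : basis M).
Implicit Types (w z v : grade N).
Notation I := (bidx b).

(* The coordinates of psi on the dual basis: its values on the basis vectors. *)
Definition dco z (psi : global_dual M z) (i : I) : F :=
  val (hom_at (psi : Hom M (pshift (Fz F (zone N)) z)) (bgr i) (bv b (bgr i) i)).

Lemma dcoE z (psi : global_dual M z) v (x : M v) :
  val (hom_at (psi : Hom M (pshift (Fz F (zone N)) z)) v x) =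
  \sum_i co b x i * dco psi i.
Proof.
rewrite (hom_bv b (psi : Hom M (pshift (Fz F (zone N)) z)) x
  (c := fun y => val y)) //.
apply: eq_bigr => i _; have [->|/co_supp iv] := eqVneq (co b x i) 0.
  by rewrite !mul0r.
by rewrite -(pmap_bv (b := b) iv) ?zle_refl // hom_nat.
Qed.

Definition dgr (i : I) : grade N := zone N - bgr i.

Lemma dgrE i z : zle (dgr i) z = zle (zone N) (z + bgr i).
Proof.
by apply/zleP/zleP => h k; have := h k; rewrite /dgr !ffunE lerBlDr.
Qed.

Lemma dco_supp z (psi : global_dual M z) i : dco psi i != 0 -> zle (dgr i) z.
Proof.
apply: contraNT; rewrite dgrE => n; apply/eqP.
exact: (subm_in (hom_at (psi : Hom M (pshift (Fz F (zone N)) z)) _ _) n).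
Qed.

Lemma dco_surj z (f : I -> F) : (forall i, f i != 0 -> zle (dgr i) z) ->
  exists psi : global_dual M z, forall i, dco psi i = f i.
Proof.
move=> fs.
pose h v (x : M v) : F := \sum_i co b x i * f i.
have P v (x : M v) : if_submod (pconst F N (z + v)) (zle (zone N) (z + v)) (h v x).
  move=> /= n; apply: big1 => i _; apply/eqP; apply: contraNT n.
  rewrite mulf_eq0 negb_or => /andP[/co_supp iv /fs].
  by rewrite dgrE => iz; apply: zle_trans iz (zleD2l z iv).
have hl v : linear (fun x : M v => mkSub (P v x) : pshift (Fz F (zone N)) z v).
  move=> a x y; apply: val_inj => /=; rewrite /h /GRing.scale /= mulr_sumr -big_split.
  by apply: eq_bigr => i _; rewrite /= co_lin mulrDl mulrA.
have hn v w (e : zle v w) x : mkLin (hl w) (pmap M e x) =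
    pmap (pshift (Fz F (zone N)) z) e (mkLin (hl v) x).
  by apply: val_inj => /=; apply: eq_bigr => i _; rewrite co_nat.
exists (mkHom hn : global_dual M z) => i; rewrite /dco /= /h.
rewrite (bigD1 i) //= big1 => [|k ki]; first by rewrite co_bv eqxx zle_refl mul1r addr0.
by rewrite co_bv (negPf ki) mul0r.
Qed.

Lemma dco_lin w a (x y : global_dual M w) i :
  dco (a *: x + y) i = a * dco x i + dco y i.
Proof.
have e (f g : Hom M (pshift (Fz F (zone N)) w)) v u :
    val (hom_at (a *: f + g) v u) = a * val (hom_at f v u) + val (hom_at g v u).
  rewrite homDE homZE. exact: erefl.
exact: e.
Qed.

Lemma dco_nat z w (h : zle z w) (x : global_dual M z) i :
  dco (pmap (global_dual M) h x) i = dco x i.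
Proof. exact: erefl. Qed.

Definition dual_basis : basis (global_dual M).
Proof.
refine (@Basis _ _ (global_dual M) I dgr dco _ _ _ dco_supp dco_surj).
- move=> w a x y i; exact: dco_lin.
- move=> z w h x i; exact: dco_nat.
- move=> z psi phi e; apply: homP => v x; apply: val_inj.
  by rewrite !dcoE; apply: eq_bigr => i _; rewrite e.
Defined.

End DualBasis.

Arguments dco {F N M} b {z} psi i.

Section MoreBases.
Variables (F : fieldType) (N : nat) (zeta : grade N).

Section Truncations.
Variables (M : pmod F N) (b : basis M).

Definition R_idx := {i : bidx b | zle (bgr i) zeta}.

Definition R_basis : basis (pR zeta M).
Proof.
refine (@Basis _ _ (pR zeta M) R_idx (fun i => bgr (val i))
  (fun w x i => co b (x : M (zmeet w zeta)) (val i)) _ _ _ _ _).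
- by move=> w a x y i; rewrite co_lin.
- by move=> z w h x i; rewrite /= co_nat.
- move=> w x y xy; apply: (co_inj b) => i.
  have [iz|iz] := boolP (zle (bgr i) zeta); first exact: (xy (exist _ i iz)).
  have c0 (u : M (zmeet w zeta)) : co b u i = 0.
    apply: contraNeq iz => /co_supp/zleP h; apply/zleP => k.
    by have := h k; rewrite ffunE le_min => /andP[].
  by rewrite !c0.
- move=> w x i /co_supp/zleP h; apply/zleP => k.
  by have := h k; rewrite ffunE le_min => /andP[].
- move=> w f fs; pose f' i := oapp f 0 (insub i : option R_idx).
  have [|x xf] := @co_surj _ _ _ b (zmeet w zeta) f'.
    move=> i; rewrite /f'; case: insubP => [j jz ji|_]; last by rewrite eqxx.
    move=> /fs/zleP jw; apply/zleP => k; rewrite ffunE le_min -ji jw /=.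
    by rewrite ji; move/zleP: jz => ->.
  by exists x => i; rewrite xf /f' valK.
Defined.

Variable S : {set 'I_N}.

Definition PS_gr (z : grade N) : grade N :=
  [ffun k => if k \in S then Num.max (z k) (zeta k + 1) else z k].

Lemma PS_grE z w : zle (PS_gr z) w = zle z w && above zeta S w.
Proof.
apply/zleP/andP => [h|[/zleP zw /forall_inP Sw] k].
  split; [apply/zleP => k | apply/forall_inP => k kS]; have := h k; rewrite ffunE.
    by case: ifP => // _; rewrite ge_max => /andP[].
  by rewrite kS ge_max => /andP[_]; rewrite lezD1.
by rewrite ffunE; case: ifP => // kS; rewrite ge_max zw lezD1 Sw.
Qed.

Definition PS_basis : basis (PS zeta S M).
Proof.
refine (@Basis _ _ (PS zeta S M) (bidx b) (fun i => PS_gr (bgr i))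
  (fun w x i => co b (val x : M w) i) _ _ _ _ _).
- by move=> w a x y i; rewrite -co_lin.
- by move=> z w h x i; rewrite -(co_nat b h).
- by move=> w x y xy; apply: val_inj; apply: (co_inj b).
- move=> w x i xi; rewrite PS_grE (co_supp xi) /=.
  apply: contraNT xi => n; have /(_ n) -> := subm_in x.
  by rewrite co0.
- move=> w f fs; have [|x xf] := @co_surj _ _ _ b w f.
    by move=> i /fs; rewrite PS_grE => /andP[].
  have P : if_submod (M w) (above zeta S w) x.
    move=> /= n; apply: (co_inj b) => i; rewrite co0 xf.
    by apply: contraNeq n => /fs; rewrite PS_grE => /andP[].
  by exists (mkSub P) => i; rewrite -xf.
Defined.

End Truncations.

Definition dsum_basis (J : finType) (M : J -> pmod F N) (b : forall j, basis (M j)) :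
  basis (pdsum M).
Proof.
refine (@Basis _ _ (pdsum M) {j : J & bidx (b j)} (fun i => bgr (tagged i))
  (fun w x i => co (b (tag i)) (x (tag i)) (tagged i)) _ _ _ _ _).
- by move=> w a x y [j i] /=; rewrite -co_lin.
- by move=> z w h x [j i] /=; rewrite -(co_nat (b j) h).
- move=> w x y xy; apply: functional_extensionality_dep => j.
  by apply: (co_inj (b j)) => i; exact: (xy (@Tagged J j (fun j => bidx (b j)) i)).
- by move=> w x [j i] /= /co_supp.
- move=> w f fs.
  have H j : exists x : M j w, forall i, co (b j) x i = f (@Tagged J j (fun j => bidx (b j)) i).
    by apply: co_surj => i /fs.
  exists ((fun j => sval (cid (H j))) : pdsum M w) => -[j i] /=.
  by case: cid => x xf; apply: xf.
Defined.

End MoreBases.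

(** * Complexes of free modules as graded matrices *)

Lemma sum_enum_val (V : nmodType) (I : finType) (f : I -> V) :
  \sum_i f i = \sum_(a < #|I|) f (enum_val a).
Proof. by rewrite -(big_enum_val f); apply: eq_bigl. Qed.

Section ComplexMatrix.
Variables (F : fieldType) (N : nat) (C : complex F N).
Variable b : forall j, basis (C j).

Definition mx_dim j : nat := #|bidx (b j)|.
Definition mx_gr j (a : 'I_(mx_dim j)) : grade N := bgr (enum_val a).
Definition mx_D i j : 'M[F]_(mx_dim i, mx_dim j) :=
  \matrix_(a, c) hmx (b i) (b j) (cdiff C i j) (enum_val a) (enum_val c).

Definition coords w j (x : C j w) : 'rV[F]_(mx_dim j) :=
  \row_a co (b j) x (enum_val a).

Lemma coords_diff w i j (x : C i w) :
  coords (cdiff C i j w x) = coords x *m mx_D i j.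
Proof.
apply/rowP => c; rewrite !mxE (hmxE (b i)) sum_enum_val.
by apply: eq_bigr => a _; rewrite !mxE.
Qed.

Lemma coords_lin w j a (x y : C j w) :
  coords (a *: x + y) = a *: coords x + coords y.
Proof. by apply/rowP => c; rewrite !mxE co_lin. Qed.

Lemma coords0 w j : coords (0 : C j w) = 0.
Proof. by apply/rowP => c; rewrite !mxE co0. Qed.

Lemma coords_inj w j : injective (@coords w j).
Proof.
move=> x y /rowP e; apply: (co_inj (b j)) => i.
by have := e (enum_rank i); rewrite !mxE enum_rankK.
Qed.

Lemma coords_nat w v j (h : zle w v) (x : C j w) :
  coords (pmap (C j) h x) = coords x.
Proof. by apply/rowP => c; rewrite !mxE co_nat. Qed.

Lemma mx_D_shape i j : i != j + 1 -> mx_D i j = 0.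
Proof. by move=> ij; apply/matrixP => a c; rewrite !mxE /hmx cdiff_shape // co0. Qed.

Lemma mx_D_sq i j k : mx_D i j *m mx_D j k = 0.
Proof.
apply/row_matrixP => a; rewrite row_mul row0.
have -> : row a (mx_D i j) =
    coords (cdiff C i j _ (bv (b i) (mx_gr a) (enum_val a))).
  by apply/rowP => c; rewrite !mxE.
by rewrite -coords_diff cdiffK coords0.
Qed.

Lemma mx_D_graded i j a c : mx_D i j a c != 0 -> zle (mx_gr c) (mx_gr a).
Proof. by rewrite mxE => /co_supp. Qed.

Definition cmx : gmat F N := Gmat mx_D_shape mx_D_sq mx_D_graded.

Lemma coords_low w j (x : C j w) : coords x *m pi cmx (low w) j = coords x.
Proof.
apply/rowP => a; rewrite piE /low /=.
have [->|] := eqVneq (coords x 0 a) 0; first by rewrite mul0rn.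
by rewrite {1}mxE => /co_supp; rewrite -/(mx_gr a) => ->.
Qed.

Lemma coords_surj w j (r : 'rV[F]_(mx_dim j)) :
  r *m pi cmx (low w) j = r -> exists x : C j w, coords x = r.
Proof.
move=> rw; have [|x xr] := @co_surj _ _ _ (b j) w (fun i => r 0 (enum_rank i)).
  move=> i; have := congr1 (fun m : 'rV_(mx_dim j) => m 0 (enum_rank i)) rw.
  rewrite /= (@piE _ _ cmx) /low /= /mx_gr enum_rankK => <-.
  by case: (zle _ _) => //; rewrite mulr0n eqxx.
by exists x; apply/rowP => a; rewrite mxE xr enum_valK.
Qed.

Lemma cycle_low w j (x : C j w) :
  (forall k, cdiff C j k w x = 0) <-> cyc (X := cmx) (low w) (coords x).
Proof.
have e k : coords x *m mD cmx (low w) j k = coords (cdiff C j k w x).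
  by rewrite /mD !mulmxA coords_low -coords_diff coords_low.
split=> [x0|[_ x0] k]; first by split=> [|k]; rewrite ?coords_low // e x0 coords0.
by apply: coords_inj; rewrite -e x0 coords0.
Qed.

Lemma boundary_low w j (x : C j w) :
  (exists y, cdiff C (j + 1) j w y = x) <-> bnd (X := cmx) (low w) (coords x).
Proof.
split=> [[y <-]|[t tx]].
  by exists (coords y); rewrite /mD !mulmxA coords_low -coords_diff coords_low.
have [|y yt] := @coords_surj w _ (t *m pi cmx (low w) (j + 1)).
  by rewrite -mulmxA pi_id.
exists y; apply: coords_inj.
by rewrite -[LHS]coords_low coords_diff yt -tx /mD !mulmxA.
Qed.

End ComplexMatrix.

(** * Minimality means that no boundary coefficient is a unit *)

Section Bijective.
Variables (F : fieldType) (N : nat).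

Lemma ciso_of_bij (C D : complex F N) (g : forall i, Hom (D i) (C i)) :
  (forall i j, hcomp (g j) (cdiff D i j) = hcomp (cdiff C i j) (g i)) ->
  (forall i z x, g i z x = 0 -> x = 0) ->
  (forall i z y, exists x, g i z x = y) ->
  ciso C D.
Proof.
move=> gd ginj gsurj.
have H i : exists f : Hom (C i) (D i), hcomp (g i) f = hid (C i) /\ hcomp f (g i) = hid (D i).
  have [|||z w h y x <-|f fP] := @hom_of_rel _ _ (C i) (D i) (fun z y x => g i z x = y).
  - by move=> z a x x' y y' <- <-; rewrite hom_linear.
  - exact: gsurj.
  - by move=> z y y0; apply: ginj y0.
  - by rewrite hom_nat.
  exists f; split; apply: homP => z x; rewrite hcompE /=; exact/fP.
pose f i := sval (cid (H i)).
have gf i : hcomp (g i) (f i) = hid (C i) by rewrite /f; case: cid => ? [].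
have fg i : hcomp (f i) (g i) = hid (D i) by rewrite /f; case: cid => ? [].
exists f, g; split=> // i j; apply: homP => z x.
rewrite -{1}[x](congr1 (fun h : Hom _ _ => h z x) (gf i)) !hcompE.
have := congr1 (fun h : Hom _ _ => h z (f i z x)) (gd i j).
rewrite !hcompE /= => <-.
by rewrite -[LHS]hcompE fg.
Qed.

End Bijective.

Section Yoneda.
Variables (F : fieldType) (N : nat).

Definition fzval (z w : grade N) (x : Fz F z w) : F := val x.

Lemma fzval_lin (z w : grade N) a (x y : Fz F z w) :
  fzval (a *: x + y) = a * fzval x + fzval y.
Proof. by []. Qed.

Lemma fzval_nat (z w v : grade N) (h : zle w v) (x : Fz F z w) :
  fzval (pmap (Fz F z) h x) = fzval x.
Proof. by []. Qed.

Lemma fzval_supp (z w : grade N) (x : Fz F z w) : ~~ zle z w -> fzval x = 0.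
Proof. by move=> n; apply: (subm_in x n). Qed.

Lemma fzval_inj (z w : grade N) : injective (@fzval z w).
Proof. exact: val_inj. Qed.

Fact fz1_in (z : grade N) : if_submod (pconst F N z) (zle z z) 1.
Proof. by rewrite /= zle_refl. Qed.

Definition fz1 (z : grade N) : Fz F z z := mkSub (@fz1_in z).

Lemma fzval1 z : fzval (fz1 z) = 1. Proof. by []. Qed.

Variables (M : pmod F N) (z : grade N) (u : M z).

Definition yon_at w : M w :=
  match boolP (zle z w) with AltTrue h => pmap M h u | AltFalse _ => 0 end.

Lemma yon_atE w (h : zle z w) : yon_at w = pmap M h u.
Proof.
rewrite /yon_at; case: {-}_ / boolP => [h'|]; last by rewrite h.
by rewrite (bool_irrelevance h' h).
Qed.

Lemma yon_linear w : linear (fun x : Fz F z w => fzval x *: yon_at w).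
Proof. by move=> a x y; rewrite fzval_lin scalerDl scalerA. Qed.

Lemma yon_nat w v (h : zle w v) (x : Fz F z w) :
  mkLin (@yon_linear v) (pmap (Fz F z) h x) = pmap M h (mkLin (@yon_linear w) x).
Proof.
rewrite /= fzval_nat linearZ_LR /=.
have [zw|zw] := boolP (zle z w).
  by rewrite (yon_atE zw) (yon_atE (zle_trans zw h)) (pmap_comp zw h (zle_trans zw h)).
by rewrite fzval_supp // !scale0r.
Qed.

(* The morphism that takes the generator to u. *)
Definition yon : Hom (Fz F z) M := mkHom yon_nat.

Lemma yonE w (h : zle z w) x : yon w x = fzval x *: pmap M h u.
Proof. by rewrite -yon_atE. Qed.

End Yoneda.

Section Projections.
Variables (F : fieldType) (N : nat) (M L : pmod F N).

Definition pfst : Hom (psum M L) M.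
Proof.
by unshelve refine (@mkHom F N (psum M L) M (fun w => mkLin (f := fun x : M w * L w => x.1) _) _).
Defined.

Definition psnd : Hom (psum M L) L.
Proof.
by unshelve refine (@mkHom F N (psum M L) L (fun w => mkLin (f := fun x : M w * L w => x.2) _) _).
Defined.

Variables (A : forall z, submod (M z)).
Variables (st : forall z w (h : zle z w) x, A z x -> A w (pmap M h x)).

Definition psub_val : Hom (psub st) M.
Proof.
by unshelve refine (@mkHom F N (psub st) M (fun w => mkLin (f := fun x : subm (A w) => val x) _) _).
Defined.

End Projections.
Arguments psub_val {F N M A} st.

(** If an element u of degree k + 1 and a linear form p in degree k satisfy
    p (boundary of u) = 1, then u and its boundary span a homological ball, and
    the form p extends to a chain map onto it: a retraction. *)
Section Splitting.
Variables (F : fieldType) (N : nat) (C : complex F N) (z : grade N) (k : int).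
Variables (u : C (k + 1) z) (p : Hom (C k) (Fz F z)).
Hypothesis pu : fzval (p z (cdiff C (k + 1) k z u)) = 1.

(* The image in C i of the generator of the ball: u in degree k + 1, its boundary
   in degree k. Sums over both cases avoid a distinction by degree. *)
Definition ball_gen i : C i z := ccast C (k + 1) i z u + cdiff C (k + 1) i z u.
Definition ball_inc i : Hom (Fz F z) (C i) := yon (ball_gen i).
Definition ball_prj i : Hom (C i) (Fz F z) := hcomp p (cdiff C i k + ccast C i k).

Lemma ball_gen1 : ball_gen (k + 1) = u.
Proof. by rewrite /ball_gen ccast_id cdiff_shape ?hom0E ?addr0 //; apply/eqP; lia. Qed.

Lemma ball_gen0 : ball_gen k = cdiff C (k + 1) k z u.
Proof. by rewrite /ball_gen ccast0 ?hom0E ?add0r //; apply/eqP; lia. Qed.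

Lemma ball_gen_out i : ~~ ball_deg k i z -> ball_gen i = 0.
Proof.
rewrite /ball_deg negb_or => /andP[i1 i0].
rewrite /ball_gen ccast0 1?eq_sym // cdiff_shape ?hom0E ?addr0 //.
by apply: contra i0 => /eqP e; apply/eqP; lia.
Qed.

Lemma ball_prjE i w x : ball_prj i w x = p w (cdiff C i k w x + ccast C i k w x).
Proof. by []. Qed.

Lemma ball_prj_out i : ~~ ball_deg k i z -> forall w x, ball_prj i w x = 0.
Proof.
rewrite /ball_deg negb_or => /andP[i1 i0] w x.
by rewrite ball_prjE ccast0 // cdiff_shape // !hom0E addr0 (linear0 (hom_lin p w)).
Qed.

Lemma ball_incE i w (x : Fz F z w) (h : zle z w) :
  ball_inc i w x = fzval x *: pmap (C i) h (ball_gen i).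
Proof. exact: yonE. Qed.

Lemma Fz_out w (x : Fz F z w) : ~~ zle z w -> x = 0.
Proof. by move=> n; apply: fzval_inj; rewrite fzval_supp. Qed.

Lemma ball_gen_prj i : ball_deg k i z -> ball_prj i z (ball_gen i) = fz1 F z.
Proof.
move=> /orP[]/eqP ->; apply: fzval_inj; rewrite ball_prjE.
  by rewrite ball_gen1 ccast0 ?hom0E ?addr0 ?pu //; apply/eqP; lia.
by rewrite ball_gen0 ccast_id cdiffK add0r.
Qed.

Lemma ball_incK i w (x : Fz F z w) : ball_deg k i z -> ball_prj i w (ball_inc i w x) = x.
Proof.
move=> ki; have [zw|zw] := boolP (zle z w); last first.
  by rewrite (Fz_out x zw) (linear0 (hom_lin _ w)) (linear0 (hom_lin _ w)).
rewrite (ball_incE _ _ zw) (linearZ_LR (hom_lin (ball_prj i) w)) /= hom_nat.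
rewrite ball_gen_prj //; apply: fzval_inj.
by rewrite -[_ *: _]addr0 fzval_lin fzval_nat fzval1 mulr1 addr0.
Qed.

Lemma ball_inc_diff i j w (x : Fz F z w) :
  cdiff C i j w (ball_inc i w x) = ball_inc j w (ball_map F z k i j w x).
Proof.
have [zw|zw] := boolP (zle z w); last first.
  by rewrite (Fz_out x zw) !(linear0 (hom_lin _ w)).
rewrite !(ball_incE _ _ zw) (linearZ_LR (hom_lin (cdiff C i j) w)) /= hom_nat.
rewrite /ball_map; case: ifP => [/andP[/eqP -> /eqP ->]|ij].
  by rewrite ball_gen1 ball_gen0.
rewrite hom0E (_ : fzval 0 = 0) // scale0r.
have [ki|/ball_gen_out ->] := boolP (ball_deg k i z); last first.
  by rewrite (linear0 (hom_lin (cdiff C i j) z)) linear0 scaler0.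
case/orP: ki ij => /eqP ->; rewrite ?ball_gen1 ?ball_gen0 ?eqxx ?cdiffK /=.
  move=> jk; rewrite cdiff_shape ?hom0E ?linear0 ?scaler0 //.
  by apply: contraFN jk => /eqP/addIr <-.
by move=> _; rewrite linear0 scaler0.
Qed.

Lemma ball_prj_diff i j w (y : C i w) :
  ball_prj j w (cdiff C i j w y) = ball_map F z k i j w (ball_prj i w y).
Proof.
rewrite /ball_map; case: ifP => [/andP[/eqP ik /eqP jk]|ij].
  subst i j; rewrite !ball_prjE ccast_id cdiffK add0r ccast0 ?hom0E ?addr0 //.
  by apply/eqP; lia.
rewrite hom0E ball_prjE cdiffK add0r.
have [jk|jk] := eqVneq j k; last by rewrite ccast0 // hom0E (linear0 (hom_lin p w)).
subst j; have -> : cdiff C i k = 0.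
  by apply: cdiff_shape; move: ij; rewrite eqxx andbT => ->.
by rewrite hom0E (linear0 (hom_lin _ w)) (linear0 (hom_lin p w)).
Qed.

(* The complement of the ball: the kernel of the retraction. *)
Definition rest_sub i w : submod (C i w).
Proof.
refine (@Submod F (C i w) (fun y => ball_prj i w y = 0) _ _).
- by rewrite (linear0 (hom_lin _ w)).
- by move=> a x y x0 y0; rewrite hom_linear x0 y0 scaler0 addr0.
Defined.

Lemma rest_stable i w v (h : zle w v) y :
  rest_sub i w y -> rest_sub i v (pmap (C i) h y).
Proof. by rewrite /= hom_nat => ->; rewrite linear0. Qed.

Definition rest_obj i : pmod F N := psub (@rest_stable i).

Lemma rest_diff_in i j w y : rest_sub i w y -> rest_sub j w (cdiff C i j w y).
Proof. by rewrite /= ball_prj_diff => ->; rewrite (linear0 (hom_lin _ w)). Qed.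

Definition rest_diff i j : Hom (rest_obj i) (rest_obj j).
Proof.
refine (@mkHom F N (rest_obj i) (rest_obj j)
  (fun w => @sub_map F _ _ _ _ (hom_lin (cdiff C i j) w) (@rest_diff_in i j w)) _).
by move=> w v h x; apply: val_inj; rewrite /= hom_nat.
Defined.

Definition rest : complex F N.
Proof.
refine (@Complex F N rest_obj rest_diff _ _).
- by move=> i j ij; apply: homP => w x; apply: val_inj; rewrite /= cdiff_shape.
- by move=> i j l; apply: homP => w x; apply: val_inj; exact: cdiffK.
Defined.

Definition glue i : Hom (csum (ball F z k) rest i) (C i) :=
  hcomp (ball_inc i) (hcomp (psub_val _) (pfst _ _)) + hcomp (psub_val _) (psnd _ _).

Lemma glueE i w x : glue i w x = ball_inc i w (val x.1) + val x.2.
Proof. by []. Qed.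

Lemma splitting : ciso C (csum (ball F z k) rest).
Proof.
apply: (@ciso_of_bij _ _ _ _ glue).
- move=> i j; apply: homP => w x; rewrite !hcompE !glueE.
  by rewrite (linearD (hom_lin (cdiff C i j) w)) /= ball_inc_diff.
- move=> i w [x y]; rewrite glueE /= => xy.
  have x0 : x = 0.
    apply: val_inj; have [ki|ki] := boolP (ball_deg k i z).
      rewrite -[LHS](ball_incK _ ki) -[ball_inc _ _ _](addrK (val y)) xy add0r.
      by rewrite (linearN (hom_lin (ball_prj i) w)) /= (subm_in y) oppr0.
    exact: (subm_in x ki).
  rewrite x0 in xy *; congr (_, _); apply: val_inj.
  by move: xy; rewrite /= (linear0 (hom_lin _ w)) add0r.
- move=> i w y.
  have P1 : if_submod (Fz F z w) (ball_deg k i w) (ball_prj i w y).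
    by move=> n; apply: (@ball_prj_out i n).
  have P2 : rest_sub i w (y - ball_inc i w (ball_prj i w y)).
    rewrite /= (linearB (hom_lin (ball_prj i) w)) /=.
    have [ki|ki] := boolP (ball_deg k i z); first by rewrite ball_incK // subrr.
    by rewrite !ball_prj_out // subr0.
  by exists (mkSub P1, mkSub P2); rewrite glueE addrC subrK.
Qed.

End Splitting.

Section Minimality.
Variables (F : fieldType) (N : nat) (C : complex F N).
Variable b : forall j, basis (C j).

Definition no_units := forall i j (a : bidx (b i)) (c : bidx (b j)),
  bgr a = bgr c -> hmx (b i) (b j) (cdiff C i j) a c = 0.

(** An invertible entry between equal grades provides u and p as above: the
    basis vector of its row and the normalized coordinate of its column. *)
Lemma minimal_no_units : minimal C -> no_units.
Proof.
move=> mC i j a c ac; apply/eqP/negPn/negP => nz.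
have ij : i = j + 1.
  apply/eqP; apply: contraNT nz => ij; apply/eqP.
  by rewrite /hmx cdiff_shape // hom0E co0.
subst i; set m := hmx _ _ _ _ _ in nz.
pose z := bgr a.
have P w (y : C j w) : if_submod (pconst F N w) (zle z w) (m^-1 * co (b j) y c).
  move=> /= n; rewrite (_ : co _ _ _ = 0) ?mulr0 //.
  by apply: contraNeq n => /co_supp; rewrite /z ac.
have pl w : linear (fun y : C j w => mkSub (P w y) : Fz F z w).
  by move=> t x y; apply: val_inj; rewrite /= co_lin mulrDr mulrCA.
have pn w v (h : zle w v) y : mkLin (pl v) (pmap (C j) h y) =
    pmap (Fz F z) h (mkLin (pl w) y).
  by apply: val_inj; rewrite /= co_nat.
apply: (mC z j _ (@splitting _ _ C z j (bv (b (j + 1)) z a) (mkHom pn) _)).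
by rewrite /fzval /= -/(hmx (b (j + 1)) (b j) (cdiff C (j + 1) j) a c) mulVf.
Qed.

(** Let q be the projection onto the lower degree of a ball that is a summand,
    read at the generating grade z. It sees only the basis elements of grade z,
    and their coefficients in a boundary come from basis elements of the same
    grade. *)
Lemma no_units_minimal : no_units -> minimal C.
Proof.
move=> nu z k D [f [g [fd gd gf fg]]].
have k1 : ball_deg k (k + 1) z by rewrite /ball_deg eqxx.
have k0 : ball_deg k k z by rewrite /ball_deg eqxx orbT.
have P i (ki : ball_deg k i z) : if_submod (Fz F z z) (ball_deg k i z) (fz1 F z).
  by rewrite /= ki.
pose e i ki : csum (ball F z k) D i z := (mkSub (P i ki), 0).
pose u := g (k + 1) z (e _ k1).
have du : cdiff C (k + 1) k z u = g k z (e _ k0).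
  rewrite /u -hcompE -gd hcompE; congr (g k z _); congr (_, _).
    by apply: val_inj; rewrite ball_diffE /ball_map !eqxx.
  by rewrite (linear0 (hom_lin _ z)).
pose q : Hom (C k) (Fz F z) :=
  hcomp (psub_val _) (hcomp (pfst _ _) (f k)).
have : fzval (q z (cdiff C (k + 1) k z u)) = 1.
  by rewrite du !hcompE -(hcompE (f k)) fg.
rewrite (hom_bv (b k) q _ (@fzval_lin _ _ z z)) big1 => [/eqP|i _].
  by rewrite eq_sym oner_eq0.
have [iz|iz] := eqVneq (bgr i) z.
  rewrite (hmxE (b (k + 1))) big1 ?mul0r // => a _.
  have [->|/co_supp az] := eqVneq (co (b (k + 1)) u a) 0; first by rewrite mul0r.
  have [->|nz] := eqVneq (hmx (b (k + 1)) (b k) (cdiff C (k + 1) k) a i) 0.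
    by rewrite mulr0.
  rewrite nu ?mulr0 //; apply: zle_anti; first by rewrite iz.
  exact: co_supp nz.
have [->|/co_supp zi] := eqVneq (co (b k) (cdiff C (k + 1) k z u) i) 0.
  by rewrite mul0r.
rewrite -(pmap_bv (b := b k) zi (zle_refl _)) hom_nat.
rewrite fzval_nat fzval_supp ?mulr0 //.
by apply: contra iz => iz; apply/eqP/zle_anti.
Qed.

End Minimality.

(** * Cocycles *)

Section Annihilators.
Variable F : fieldType.

(** A linear form on a row kernel is the restriction of one on all rows. *)
Lemma functional_row n q (B : 'M[F]_(n, q)) (l : 'rV[F]_n -> F) :
  (forall a x y, x *m B = 0 -> y *m B = 0 -> l (a *: x + y) = a * l x + l y) ->
  exists phi : 'cV[F]_n, forall x, x *m B = 0 -> l x = (x *m phi) 0 0.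
Proof.
move=> ll; pose K := kermx B.
have KB m (c : 'M_(m, n)) : c *m K *m B = 0 by rewrite -mulmxA mulmx_ker mulmx0.
have l0 : l 0 = 0.
  by have := ll (-1) 0 0 (mul0mx _ _) (mul0mx _ _); rewrite scaler0 addr0 mulN1r addNr.
have lK (c : 'rV_n) : l (c *m K) = \sum_i c 0 i * l (row i K).
  rewrite mulmx_sum_row.
  suff [] : (\sum_i c 0 i *: row i K) *m B = 0 /\
    l (\sum_i c 0 i *: row i K) = \sum_i c 0 i * l (row i K) by [].
  apply: (big_ind2 (fun v s => v *m B = 0 /\ l v = s)) => [|v s v' s' [vB vs] [v'B v's]|i _].
  - by rewrite mul0mx.
  - split; first by rewrite mulmxDl vB v'B addr0.
    by rewrite -[v]scale1r ll // mul1r vs v's.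
  - have rB : row i K *m B = 0 by rewrite rowE KB.
    split; first by rewrite -scalemxAl rB scaler0.
    by have := ll (c 0 i) (row i K) 0 rB (mul0mx _ _); rewrite !addr0 l0 addr0.
exists (pinvmx K *m \col_i l (row i K)) => x /sub_kermxP xK.
rewrite mulmxA -{1}(mulmxKpV xK) lK mxE; apply: eq_bigr => i _.
by rewrite [X in _ = _ * X]mxE.
Qed.

Lemma functional_col n q (A : 'M[F]_(q, n)) (l : 'cV[F]_n -> F) :
  (forall a x y, A *m x = 0 -> A *m y = 0 -> l (a *: x + y) = a * l x + l y) ->
  exists y : 'rV[F]_n, forall x, A *m x = 0 -> l x = (y *m x) 0 0.
Proof.
move=> ll; have [|phi h] := @functional_row _ _ A^T (fun x => l x^T).
  move=> a x y xA yA; rewrite linearP /= ll //; apply: trmx_inj.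
    by rewrite trmx_mul trmxK trmx0.
  by rewrite trmx_mul trmxK trmx0.
exists phi^T => x xA; rewrite -[in LHS](trmxK x) h -?trmx_mul ?xA ?trmx0 //.
by rewrite -{1}[phi]trmxK -trmx_mul mxE.
Qed.

Lemma annihilator_row n q (A : 'M[F]_(q, n)) (y : 'rV[F]_n) :
  (forall phi : 'cV_n, A *m phi = 0 -> (y *m phi) 0 0 = 0) ->
  exists t, t *m A = y.
Proof.
move=> h; have /submxP[t ->] : (y <= A)%MS; last by exists t.
rewrite submxE; apply/eqP/rowP => c; rewrite [RHS]mxE.
have := h (cokermx A *m delta_mx c 0).
by rewrite mulmxA mulmx_coker mul0mx mulmxA -colE mxE => /(_ erefl).
Qed.

Lemma annihilator_col n q (B : 'M[F]_(n, q)) (phi : 'cV[F]_n) :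
  (forall y : 'rV_n, y *m B = 0 -> (y *m phi) 0 0 = 0) ->
  exists psi, B *m psi = phi.
Proof.
move=> h; have [|t tB] := @annihilator_row _ _ B^T phi^T.
  move=> y By; have := h y^T; rewrite -{1}[B]trmxK -trmx_mul By trmx0 => /(_ erefl).
  by rewrite -{1}[phi]trmxK -trmx_mul mxE.
by exists t^T; rewrite -[phi]trmxK -tB trmx_mul trmxK.
Qed.

End Annihilators.

Section Cocycles.
Variables (F : fieldType) (N : nat) (X : gmat F N) (P : grade N -> bool) (k : int).
Hypothesis cP : convex P.

Definition cocyc (phi : 'cV[F]_(gn X k)) : Prop :=
  pi X P k *m phi = phi /\ forall i, mD X P i k *m phi = 0.

Definition cobnd (phi : 'cV[F]_(gn X k)) : Prop :=
  exists psi, mD X P k (k - 1) *m psi = phi.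

Lemma cocycS (phi : 'cV[F]_(gn X k)) :
  pi X P k *m phi = phi -> mD X P (k + 1) k *m phi = 0 -> cocyc phi.
Proof.
move=> pphi h; split=> // i; have [->//|ik] := eqVneq i (k + 1).
by rewrite mD_shape // mul0mx.
Qed.

Lemma cocyc_lin a phi psi : cocyc phi -> cocyc psi -> cocyc (a *: phi + psi).
Proof.
move=> [phiP phiD] [psiP psiD]; split=> [|i]; rewrite mulmxDr -scalemxAr.
  by rewrite phiP psiP.
by rewrite phiD psiD scaler0 addr0.
Qed.

Lemma bnd_cocyc (y : 'rV_(gn X k)) phi : bnd P y -> cocyc phi -> y *m phi = 0.
Proof. by move=> [t <-] [_ h]; rewrite -mulmxA h mulmx0. Qed.

Lemma cyc_cobnd (y : 'rV_(gn X k)) phi : cyc P y -> cobnd phi -> y *m phi = 0.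
Proof. by move=> [_ h] [psi <-]; rewrite mulmxA h mul0mx. Qed.

(** Linear forms on homology are cohomology classes, and conversely: over a
    field, duality is exact. *)
Lemma functional_cocyc (l : 'rV_(gn X k) -> F) :
  (forall a x y, cyc P x -> cyc P y -> l (a *: x + y) = a * l x + l y) ->
  (forall x, bnd P x -> l x = 0) ->
  exists2 phi, cocyc phi & forall x, cyc P x -> l x = (x *m phi) 0 0.
Proof.
move=> ll lb; pose B := row_mx (1%:M - pi X P k) (mD X P k (k - 1)).
have cB x : x *m B = 0 <-> cyc P x.
  rewrite /B mul_mx_row; split=> [/eqP|[xP xD]].
    rewrite -row_mx0 => /eqP/eq_row_mx[]; rewrite mulmxBr mulmx1 => /eqP.
    by rewrite subr_eq0 => /eqP e xD; apply: cycB.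
  by rewrite mulmxBr mulmx1 xP subrr xD row_mx0.
have [|phi h] := @functional_row _ _ _ B l.
  by move=> a x y /cB xc /cB yc; apply: ll.
exists (pi X P k *m phi); last first.
  by move=> x xc; rewrite mulmxA; case: (xc) => -> _; apply/h/cB.
apply: cocycS; first by rewrite mulmxA pi_id.
rewrite mulmxA mD_pi; apply/row_matrixP => i; rewrite row0 row_mul.
have rb : bnd P (row i (mD X P (k + 1) k)) by rewrite rowE; exists (delta_mx 0 i).
apply/rowP => c; rewrite (ord1 c) -h ?lb ?mxE //.
exact/cB/(bnd_cyc cP).
Qed.

Lemma functional_cyc (l : 'cV_(gn X k) -> F) :
  (forall a phi psi, cocyc phi -> cocyc psi ->
     l (a *: phi + psi) = a * l phi + l psi) ->
  (forall phi, cobnd phi -> l phi = 0) ->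
  exists2 y, cyc P y & forall phi, cocyc phi -> l phi = (y *m phi) 0 0.
Proof.
move=> ll lb; pose A := col_mx (1%:M - pi X P k) (mD X P (k + 1) k).
have cA x : A *m x = 0 <-> cocyc x.
  rewrite /A mul_col_mx; split=> [/eqP|[xP xD]].
    rewrite -col_mx0 => /eqP/eq_col_mx[]; rewrite mulmxBl mul1mx => /eqP.
    by rewrite subr_eq0 => /eqP e xD; apply: cocycS.
  by rewrite mulmxBl mul1mx xP subrr xD col_mx0.
have [|y h] := @functional_col _ _ _ A l.
  by move=> a x z /cA xc /cA zc; apply: ll.
exists (y *m pi X P k); last first.
  by move=> x xc; rewrite -mulmxA; case: (xc) => -> _; apply/h/cA.
apply: cycB; first by rewrite -mulmxA pi_id.
rewrite -mulmxA pi_mD; apply/rowP => c; rewrite [RHS]mxE.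
have cb : cobnd (col c (mD X P k (k - 1))) by rewrite colE; exists (delta_mx c 0).
have -> : (y *m mD X P k (k - 1)) 0 c = (y *m col c (mD X P k (k - 1))) 0 0.
  by rewrite colE mulmxA -colE [RHS]mxE.
rewrite -h ?lb //.
apply/cA; case: cb => psi <-; split=> [|i]; first by rewrite mulmxA pi_mD.
by rewrite mulmxA mD_sq // mul0mx.
Qed.

Lemma cocyc_bnd (y : 'rV_(gn X k)) : y *m pi X P k = y ->
  (forall phi, cocyc phi -> (y *m phi) 0 0 = 0) -> bnd P y.
Proof.
move=> yP h; apply: annihilator_row => phi A0.
by rewrite -yP -mulmxA h //; apply: cocycS; rewrite mulmxA ?pi_id ?mD_pi.
Qed.

Lemma cyc_cob (phi : 'cV_(gn X k)) : pi X P k *m phi = phi ->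
  (forall y, cyc P y -> (y *m phi) 0 0 = 0) -> cobnd phi.
Proof.
move=> pphi h; apply: annihilator_col => y B0.
by rewrite -pphi mulmxA h //; apply: cycB; rewrite -mulmxA ?pi_id ?pi_mD.
Qed.

End Cocycles.

Lemma high_convex N (w : grade N) : convex (high w).
Proof.
move=> z v u _ /zleP uv _ /forallP wu; apply/forallP => i.
exact: lt_le_trans (wu i) (uv i).
Qed.

(** * Transfer of classes *)

(** X is the complex whose homology is to be resolved, G the resolution of its
    cohomology, and e the augmentation of G, seen as a relation between chains
    of G and cocycles of X. Both linking relations shift degrees by the same
    amount; a cocycle psi of G and a cycle x of X correspond when the pairing of
    psi with the link of u agrees with the pairing of phi with the link of x
    whenever u augments to the class of phi. All three relations are
    isomorphisms on classes, hence so is the correspondence. *)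
Section Transfer.
Variables (F : fieldType) (N : nat) (X G : gmat F N) (j kX i kG : int).
Variables (rX : grade N -> 'rV[F]_(gn X j) -> 'rV[F]_(gn X kX) -> Prop).
Variables (rG : grade N -> 'rV[F]_(gn G i) -> 'rV[F]_(gn G kG) -> Prop).
Variables (e : grade N -> 'rV[F]_(gn G i) -> 'cV[F]_(gn X kX) -> Prop).
Hypotheses (hX : link rX) (hG : link rG).
Hypothesis e_cyc : forall z u phi, e z u phi -> cyc (low (- z)) u.
Hypothesis e_coc : forall z u phi, e z u phi -> cocyc (high z) phi.
Hypothesis e_lin : forall z a u u' phi phi',
  e z u phi -> e z u' phi' -> e z (a *: u + u') (a *: phi + phi').
Hypothesis e_dom : forall z u, cyc (low (- z)) u -> exists phi, e z u phi.
Hypothesis e_cod : forall z phi, cocyc (high z) phi -> exists u, e z u phi.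
Hypothesis e_bnd : forall z u phi,
  e z u phi -> bnd (low (- z)) u <-> cobnd (high z) phi.
Hypothesis e_nat : forall z w u phi, zle z w -> e w u phi -> e z u phi.

Definition transfer z (psi : 'cV[F]_(gn G kG)) (x : 'rV[F]_(gn X j)) : Prop :=
  [/\ cyc (low z) x, cocyc (high (- z)) psi & exists2 y, rX z x y &
     forall u phi v, e z u phi -> rG (- z) u v -> v *m psi = y *m phi].

Lemma transfer_lin z a psi psi' x x' : transfer z psi x -> transfer z psi' x' ->
  transfer z (a *: psi + psi') (a *: x + x').
Proof.
move=> [cx cp [y xy h]] [cx' cp' [y' xy' h']].
split; [exact: cyc_lin|exact: cocyc_lin|].
exists (a *: y + y'); first exact: link_lin.
move=> u phi v euv rv.
by rewrite mulmxDr mulmxDl -scalemxAr -scalemxAl (h u phi v) ?(h' u phi v).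
Qed.

(** The value of psi on the link of u only depends on the class of phi, so psi
    induces a linear form on cohomology, which a cycle of X represents. *)
Lemma transfer_dom z psi : cocyc (high (- z)) psi -> exists x, transfer z psi x.
Proof.
move=> cp.
have H phi : exists s, cocyc (high z) phi ->
    forall u v, e z u phi -> rG (- z) u v -> (v *m psi) 0 0 = s.
  have [|n] := pselect (cocyc (high z) phi); last by exists 0 => /n.
  move=> /e_cod[u0 e0]; have [v0 r0] := link_dom hG (e_cyc e0).
  exists ((v0 *m psi) 0 0) => _ u v eu rv; apply/eqP; rewrite -subr_eq0.
  have b : bnd (high (- z)) (- v0 + v).
    rewrite -scaleN1r; have r := link_lin hG (-1) r0 rv.
    apply/(link_bnd hG r)/(e_bnd (e_lin (-1) e0 eu)).
    by rewrite scaleN1r addNr; exists 0; rewrite mulmx0.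
  have := bnd_cocyc b cp; rewrite mulmxDl mulNmx => /matrixP/(_ 0 0).
  by rewrite !mxE addrC => ->.
pose l phi := sval (cid (H phi)).
have lE phi u v : e z u phi -> rG (- z) u v -> l phi = (v *m psi) 0 0.
  move=> eu rv; rewrite /l; case: cid => s /= h; symmetry.
  exact: h (e_coc eu) u v eu rv.
have [||y cy yl] := @functional_cyc _ _ X (high z) kX (@high_convex N z) l.
- move=> a phi phi' cphi cphi'.
  have [u eu] := e_cod cphi; have [v rv] := link_dom hG (e_cyc eu).
  have [u' eu'] := e_cod cphi'; have [v' rv'] := link_dom hG (e_cyc eu').
  rewrite (lE _ _ _ eu rv) (lE _ _ _ eu' rv').
  rewrite (lE _ _ _ (e_lin a eu eu') (link_lin hG a rv rv')).
  by rewrite mulmxDl -scalemxAl !mxE.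
- move=> phi cphi; have cphi' : cocyc (high z) phi.
    case: cphi => s <-; split=> [|k]; first by rewrite mulmxA pi_mD.
    by rewrite mulmxA mD_sq ?mul0mx //; apply: high_convex.
  have [u eu] := e_cod cphi'; have [v rv] := link_dom hG (e_cyc eu).
  rewrite (lE _ _ _ eu rv) (bnd_cocyc _ cp) ?mxE //.
  exact/(link_bnd hG rv)/(e_bnd eu).
have [x xy] := link_cod hX cy; exists x; split=> //; first exact: link_l xy.
exists y => // u phi v eu rv; apply/matrixP => r s; rewrite !ord1.
by rewrite -(lE _ _ _ eu rv) yl //; apply: e_coc eu.
Qed.

(** Conversely the link of x induces a linear form on the homology of G, which a
    cocycle represents. *)
Lemma transfer_cod z x : cyc (low z) x -> exists psi, transfer z psi x.
Proof.
move=> cx; have [y xy] := link_dom hX cx.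
have cy := link_r hX xy.
have H v : exists s, cyc (high (- z)) v ->
    forall u phi, e z u phi -> rG (- z) u v -> (y *m phi) 0 0 = s.
  have [|n] := pselect (cyc (high (- z)) v); last by exists 0 => /n.
  move=> /(link_cod hG)[u0 r0]; have [phi0 e0] := e_dom (link_l hG r0).
  exists ((y *m phi0) 0 0) => _ u phi eu rv; apply/eqP; rewrite -subr_eq0.
  have b : cobnd (high z) (- phi0 + phi).
    rewrite -scaleN1r; apply/(e_bnd (e_lin (-1) e0 eu)).
    apply/(link_bnd hG (link_lin hG (-1) r0 rv)).
    by rewrite scaleN1r addNr; apply: bnd0.
  have := cyc_cobnd cy b; rewrite mulmxDr mulmxN => /matrixP/(_ 0 0).
  by rewrite !mxE addrC => ->.
pose l v := sval (cid (H v)).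
have lE u phi v : e z u phi -> rG (- z) u v -> l v = (y *m phi) 0 0.
  move=> eu rv; rewrite /l; case: cid => s /= h; symmetry.
  exact: h (link_r hG rv) u phi eu rv.
have [||psi cp pl] := @functional_cocyc _ _ G (high (- z)) kG (@high_convex N _) l.
- move=> a v v' cv cv'.
  have [u ru] := link_cod hG cv; have [phi eu] := e_dom (link_l hG ru).
  have [u' ru'] := link_cod hG cv'; have [phi' eu'] := e_dom (link_l hG ru').
  rewrite (lE _ _ _ eu ru) (lE _ _ _ eu' ru').
  rewrite (lE _ _ _ (e_lin a eu eu') (link_lin hG a ru ru')).
  by rewrite mulmxDr -scalemxAr !mxE.
- move=> v bv; have cv := bnd_cyc (@high_convex N _) bv.
  have [u ru] := link_cod hG cv; have [phi eu] := e_dom (link_l hG ru).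
  rewrite (lE _ _ _ eu ru) (cyc_cobnd cy) ?mxE //.
  exact/(e_bnd eu)/(link_bnd hG ru).
exists psi; split=> //; exists y => // u phi v eu rv.
apply/matrixP => r s; rewrite !ord1 -(lE _ _ _ eu rv) pl //.
exact: link_r rv.
Qed.

Lemma transfer_bnd z psi x : transfer z psi x ->
  bnd (low z) x <-> cobnd (high (- z)) psi.
Proof.
move=> [cx cp [y xy h]]; have cy := link_r hX xy.
split=> [/(link_bnd hX xy) by_|bp].
  apply: cyc_cob; first by case: cp.
  move=> v /(link_cod hG)[u rv]; have [phi eu] := e_dom (link_l hG rv).
  by rewrite (h u phi v) // (bnd_cocyc by_ (e_coc eu)) mxE.
apply/(link_bnd hX xy); apply: cocyc_bnd; first by case: cy.
move=> phi /e_cod[u eu]; have [v rv] := link_dom hG (e_cyc eu).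
by rewrite -(h u phi v) // (cyc_cobnd (link_r hG rv) bp) mxE.
Qed.

Lemma transfer_nat z w psi x : zle z w -> transfer z psi x ->
  cyc (low w) x -> cocyc (high (- w)) psi -> transfer w psi x.
Proof.
move=> zw [_ cp [y xy h]] cx' cp'; split=> //.
exists (y *m pi X (high w) _); first exact: link_nat xy.
move=> u phi v eu rv; rewrite -mulmxA (e_coc eu).1.
have wz : zle (- w) (- z).
  by move/zleP: zw => zw; apply/zleP => c; rewrite !ffunE lerN2.
rewrite -(h u phi (v *m pi G (high (- z)) _)); first by rewrite -mulmxA cp.1.
  exact: e_nat eu.
exact: link_nat rv.
Qed.

End Transfer.

(** * Coordinates of the dual complex *)

Section DualCoords.
Variables (F : fieldType) (N : nat) (C : complex F N).
Variable b : forall j, basis (C j).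

Definition dcol z j (psi : global_dual (C j) z) : 'cV[F]_(mx_dim b j) :=
  \col_a dco (b j) psi (enum_val a).

Lemma dcol_lin z j a (psi phi : global_dual (C j) z) :
  dcol (a *: psi + phi) = a *: dcol psi + dcol phi.
Proof. by apply/colP => i; rewrite !mxE dco_lin. Qed.

Lemma dcol0 z j : dcol (0 : global_dual (C j) z) = 0.
Proof.
have := dcol_lin (-1) (0 : global_dual (C j) z) 0.
by rewrite !scaleN1r !addNr.
Qed.

Lemma dcol_nat z w j (h : zle z w) (psi : global_dual (C j) z) :
  dcol (pmap (global_dual (C j)) h psi) = dcol psi.
Proof. by apply/colP => i; rewrite !mxE dco_nat. Qed.

Lemma dcol_inj z j : injective (@dcol z j).
Proof.
move=> psi phi /colP e; apply: (co_inj (dual_basis (b j))) => i.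
by have := e (enum_rank i); rewrite !mxE enum_rankK.
Qed.

(** This is why the dual at z is the linear dual of the elements that exceed - z
    in all coordinates. *)
Lemma high_dgr z j (i : bidx (b j)) : zle (dgr i) z = high (- z) (bgr i).
Proof.
apply/zleP/forallP => h k; have := h k; rewrite !ffunE lerBlDr -lerBlDl.
  by rewrite -lezD1 addrC.
by rewrite -lezD1 addrC.
Qed.

Lemma dcol_high z j (psi : global_dual (C j) z) :
  pi (cmx b) (high (- z)) j *m dcol psi = dcol psi.
Proof.
apply/colP => a; rewrite pi_lE /= /mx_gr -high_dgr.
have [->|] := eqVneq (dcol psi a 0) 0; first by rewrite mul0rn.
by rewrite {1}mxE => /dco_supp ->.
Qed.

Lemma dcol_surj z j (phi : 'cV[F]_(mx_dim b j)) :
  pi (cmx b) (high (- z)) j *m phi = phi ->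
  exists psi : global_dual (C j) z, dcol psi = phi.
Proof.
move=> ph; have [|psi h] := @dco_surj _ _ _ (b j) z (fun i => phi (enum_rank i) 0).
  move=> i; have := congr1 (fun m : 'cV_(mx_dim b j) => m (enum_rank i) 0) ph.
  rewrite /= (@pi_lE _ _ (cmx b)) /= /mx_gr enum_rankK high_dgr => <-.
  by case: (high _ _) => //; rewrite mulr0n eqxx.
by exists psi; apply/colP => a; rewrite mxE h enum_valK.
Qed.

Lemma dcol_diff z i j (psi : global_dual (C j) z) :
  dcol (global_dual_hom (cdiff C i j) z psi) = mx_D b i j *m dcol psi.
Proof.
apply/colP => a; rewrite !mxE /dco global_dual_homE hcompE (dcoE (b j)) sum_enum_val.
by apply: eq_bigr => c _; rewrite !mxE.
Qed.

Lemma dcol_mD z i j (psi : global_dual (C j) z) :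
  mD (cmx b) (high (- z)) i j *m dcol psi =
  dcol (global_dual_hom (cdiff C i j) z psi).
Proof. by rewrite /mD -!mulmxA dcol_high -dcol_diff dcol_high. Qed.

Lemma cocycle_high z j (psi : global_dual (C j) z) :
  (forall i, global_dual_hom (cdiff C i j) z psi = 0) <->
  cocyc (X := cmx b) (high (- z)) (dcol psi).
Proof.
split=> [h|[_ h] i]; first by split=> [|i]; rewrite ?dcol_high // dcol_mD h dcol0.
by apply: dcol_inj; rewrite -dcol_mD h dcol0.
Qed.

Lemma coboundary_high z j l (psi : global_dual (C j) z) : l = j - 1 ->
  (exists phi, global_dual_hom (cdiff C j l) z phi = psi) <->
  cobnd (X := cmx b) (high (- z)) (dcol psi).
Proof.
move=> ->; split=> [[phi <-]|[t tx]]; first by exists (dcol phi); rewrite dcol_mD.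
have [|phi pt] := @dcol_surj z _ (pi (cmx b) (high (- z)) (j - 1) *m t).
  by rewrite mulmxA pi_id.
by exists phi; apply: dcol_inj; rewrite -dcol_mD pt mulmxA mD_pi.
Qed.

End DualCoords.

(** * Homology classes *)

Section Classes.
Variables (F : fieldType) (N : nat) (D : complex F N) (d : int).

Definition has_class w (x : D d w) (h : homology D d w) : Prop :=
  exists2 s : cycles D d w, val s = x & qpi (@boundary_submod F N D d w) s = h.

Lemma cls_ex w (h : homology D d w) : exists x, has_class x h.
Proof. by exists (val (qrepr h)), (qrepr h) => //; apply: qreprK. Qed.

Lemma cls_cyc w (x : D d w) h : has_class x h -> cdiff D d (d - 1) w x = 0.
Proof. by move=> [s <- _]; apply: (subm_in s). Qed.

Lemma cls_of w (x : D d w) : cdiff D d (d - 1) w x = 0 -> exists h, has_class x h.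
Proof.
move=> x0; have P : cycle_submod D d w x by [].
by exists (qpi (@boundary_submod F N D d w) (mkSub P)), (mkSub P).
Qed.

Lemma cls_lin w a (x y : D d w) h k :
  has_class x h -> has_class y k -> has_class (a *: x + y) (a *: h + k).
Proof.
move=> [s <- <-] [t <- <-]; exists (a *: s + t) => //; exact: qpi_linear.
Qed.

Lemma cls0 w (x : D d w) h : has_class x h ->
  h = 0 <-> exists y, cdiff D (d + 1) d w y = x.
Proof.
move=> [s sx <-]; rewrite -[X in _ = X](linear0 (qpi (@boundary_submod F N D d w))).
rewrite qpi_eq subr0 /= sx; split=> -[y yx]; exists y => //.
Qed.

Lemma cls_nat w v (le : zle w v) (x : D d w) h :
  has_class x h -> has_class (pmap (D d) le x) (pmap (homology D d) le h).
Proof.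
move=> [s <- <-]; exists (pmap (cycles D d) le s) => //.
rewrite /= /quo_map /= quo_funE //; exact: boundary_stable.
Qed.

End Classes.

(** * The dual of a resolution of cohomology resolves homology *)

Section Duality.
Variables (F : fieldType) (N : nat) (X G : complex F N) (d : int) (top : grade N).
Variables (bX : forall j, basis (X j)) (bG : forall j, basis (G j)).
Hypothesis Xtop : forall w, ~~ zle w top -> forall j (x : X j w),
  cdiff X j (j - 1) w x = 0 -> exists y, cdiff X (j + 1) j w y = x.
Hypothesis Gres : resolution G (cohomology (cdual X) (d + N%:Z)).
Hypothesis Gmin : minimal G.

Notation kX := (- - (d + N%:Z)).
Notation kG := (- 0 + N%:Z).
Notation DX := (cdual X).
Notation e0 := (- (d + N%:Z)).

Lemma cyc_cdiff (C : complex F N) j w (x : C j w) :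
  cdiff C j (j - 1) w x = 0 <-> forall k, cdiff C j k w x = 0.
Proof.
split=> [x0 k|//]; have [jk|jk] := eqVneq j (k + 1); last by rewrite cdiff_shape.
by rewrite (_ : k = j - 1) // jk addrK.
Qed.

Lemma coc_cdiff (C : complex F N) j w (psi : global_dual (C (- j)) w) :
  cdiff (cdual C) j (j - 1) w psi = 0 <->
  forall i, global_dual_hom (cdiff C i (- j)) w psi = 0.
Proof.
split=> [x0 i|h]; last exact: h.
have [ij|ij] := eqVneq i (- j + 1).
  by rewrite ij -[- j + 1](_ : - (j - 1) = _) ?x0 // opprB addrC.
by rewrite cdiff_shape // global_dual_homE hcomp0r.
Qed.

Lemma exact_cmx (C : complex F N) (b : forall j, basis (C j)) w j :
  (forall x, cdiff C j (j - 1) w x = 0 -> exists y, cdiff C (j + 1) j w y = x) ->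
  exact (cmx b) (low w) j.
Proof.
move=> h x cx; have [x' x'x] := @coords_surj _ _ _ b w j x cx.1.
rewrite -x'x in cx *; apply/boundary_low/h.
by apply/cyc_cdiff; apply/(cycle_low b).
Qed.

Lemma X_link : exists r, @link F N (cmx bX) d kX r.
Proof.
apply: (@exists_link _ _ (cmx bX) top) => [w nw j|]; last by rewrite opprK.
by apply: exact_cmx => x; apply: Xtop.
Qed.

Lemma G_neg i : i < 0 -> gn (cmx bG) i = 0%N.
Proof.
move=> i0; apply/eqP; rewrite -leqn0 leqNgt; apply/negP => n0.
pose a := enum_val (Ordinal n0 : 'I_(mx_dim bG i)).
have := co_bv (b := bG i) (bgr a) a a.
by rewrite (Gres.1 i i0 _ (bv (bG i) (bgr a) a)) co0 eqxx zle_refl => /eqP; rewrite eq_sym oner_eq0.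
Qed.

Lemma exact_neg i w : i < 0 -> exact (cmx bG) (low w) i.
Proof.
move=> /G_neg n0 x _; exists 0; rewrite mul0mx.
by apply/rowP => a; exfalso; case: a; rewrite n0.
Qed.

Lemma exact_pos i w : 0 < i -> exact (cmx bG) (low w) i.
Proof. by move=> i0; apply: exact_cmx => x; case: Gres.2 => eps [_ _ /(_ i i0 w x)[]]. Qed.

Lemma G_long i : N%:Z < i -> gn (cmx bG) i = 0%N.
Proof.
apply: syzygy => [w j j0|i' j a c ac]; first exact: exact_pos.
by rewrite /= mxE; apply: minimal_no_units.
Qed.

Section Augmentation.
Variable eps : Hom (G 0) (cohomology DX (d + N%:Z)).
Hypothesis eps_surj : forall z (y : cohomology DX (d + N%:Z) z),
  exists x, eps z x = y.
Hypothesis eps_ker : forall z x, eps z x = 0 <-> exists y, cdiff G 1 0 z y = x.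

(* The augmentation in coordinates: u at grade - z maps to the class of phi. *)
Definition aug z (u : 'rV[F]_(gn (cmx bG) 0)) (phi : 'cV[F]_(gn (cmx bX) kX)) : Prop :=
  exists (u' : G 0 (- z)) (phi' : DX e0 (- z)),
    [/\ coords bG u' = u, dcol bX (phi' : global_dual (X kX) (- z)) = phi
      & has_class phi' (eps (- z) u')].

Lemma aug_cyc z u phi : aug z u phi -> cyc (low (- z)) u.
Proof.
move=> [u' [_ [<- _ _]]]; apply/(cycle_low bG) => k.
have [k0|k0] := ltrP k 0; first exact: Gres.1.
by rewrite cdiff_shape //; apply/eqP; lia.
Qed.

Lemma aug_coc z u phi : aug z u phi -> cocyc (high z) phi.
Proof.
move=> [_ [phi' [_ <- /cls_cyc/coc_cdiff/(cocycle_high bX)]]].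
by rewrite (opprK z).
Qed.

Lemma aug_lin z a u u' phi phi' : aug z u phi -> aug z u' phi' ->
  aug z (a *: u + u') (a *: phi + phi').
Proof.
move=> [x [f [<- <- xf]]] [x' [f' [<- <- xf']]]; exists (a *: x + x'), (a *: f + f').
by rewrite coords_lin dcol_lin hom_linear; split=> //; apply: cls_lin.
Qed.

Lemma aug_dom z u : cyc (low (- z)) u -> exists phi, aug z u phi.
Proof.
move=> [uz _]; have [u' uu'] := coords_surj uz.
have [phi' h] := cls_ex (eps (- z) u').
by exists (dcol bX (phi' : global_dual (X kX) (- z))), u', phi'.
Qed.

Lemma aug_cod z phi : cocyc (high z) phi -> exists u, aug z u phi.
Proof.
rewrite -{1}(opprK z) => cphi; have [phi' phiE] := dcol_surj cphi.1.
have [|h ph] := @cls_of _ _ DX e0 (- z) phi'.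
  by apply/coc_cdiff/(cocycle_high bX); rewrite phiE.
have [u' uh] := eps_surj h.
by exists (coords bG u'), u', phi'; split=> //; rewrite uh.
Qed.

Lemma aug_bnd z u phi : aug z u phi -> bnd (low (- z)) u <-> cobnd (high z) phi.
Proof.
move=> [u' [phi' [<- <- h]]].
have := @coboundary_high F N X bX (- z) kX (- (e0 + 1)) phi' (opprD _ _).
rewrite (opprK z) => <-; rewrite -(@boundary_low _ _ _ bG).
by apply: iff_trans (cls0 h); symmetry; apply: eps_ker.
Qed.

Lemma aug_nat z w u phi : zle z w -> aug w u phi -> aug z u phi.
Proof.
move=> /zleP zw [u' [phi' [<- <- h]]].
have wz : zle (- w) (- z) by apply/zleP => k; rewrite !ffunE lerN2.
exists (pmap (G 0) wz u'), (pmap (DX e0) wz phi'); split.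
- exact: coords_nat.
- exact: dcol_nat.
- by rewrite hom_nat; apply: cls_nat.
Qed.

(** If no basis element of X d lies below - w, then the link makes every
    cocycle at w a coboundary, so the module that G resolves vanishes at w.
    This happens for all w outside a lower set, as X d has finite rank. *)
Lemma exact_deg0 : exists b : grade N,
  forall w, ~~ zle w b -> exact (cmx bG) (low w) 0.
Proof.
have [r hr] := X_link.
have [m [m0 mP]] := grades_bounded (cmx bX) d.
pose M : int := \sum_(a : 'I_(gn (cmx bX) d)) \sum_k `|gg a k|.
have MP (a : 'I_(gn (cmx bX) d)) k : - gg a k <= M.
  rewrite (le_trans (ler_norm _)) // normrN /M (bigD1 a) //= (bigD1 k) //= -addrA.
  rewrite lerDl addr_ge0 // sumr_ge0 // => c _; exact: sumr_ge0.
exists [ffun => M] => w wb; rewrite -(opprK w) => u cu.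
have [phi a] := aug_dom cu; apply/(aug_bnd a); apply: cyc_cob.
  by case: (aug_coc a).
move=> y /(link_cod hr)[x xy].
suff x0 : x = 0.
  rewrite (bnd_cocyc _ (aug_coc a)) ?mxE //; apply/(link_bnd hr xy).
  by rewrite x0; apply: bnd0.
apply/rowP => c; rewrite -(link_l hr xy).1 piE [RHS]mxE /low.
case: (boolP (zle _ _)) => [/zleP h|_ //]; case/negP: wb; apply/zleP => k.
rewrite ffunE; apply: le_trans (MP c k); have := h k.
by rewrite ffunE lerNr.
Qed.

Lemma G_link i k : k = i + N%:Z -> exists r, @link F N (cmx bG) i k r.
Proof.
have [b hb] := exact_deg0; apply: (@exists_link _ _ (cmx bG) b) => w wb j.
have [j0|j0|->] := ltrgtP j 0; [exact: exact_neg|exact: exact_pos|exact: hb].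
Qed.

Notation DG := (cdual (cshift G N%:Z)).

Lemma DG_cocycle i z (psi : global_dual (G (- i + N%:Z)) z) :
  cdiff DG i (i - 1) z psi = 0 <-> cocyc (X := cmx bG) (high (- z)) (dcol bG psi).
Proof.
rewrite -cocycle_high; split=> h; last exact: h.
move=> l; have := (@coc_cdiff (cshift G N%:Z) i z psi).1 h (l - N%:Z).
by rewrite /= subrK.
Qed.

Lemma DG_coboundary i z (psi : global_dual (G (- i + N%:Z)) z) :
  (exists phi, cdiff DG (i + 1) i z phi = psi) <->
  cobnd (X := cmx bG) (high (- z)) (dcol bG psi).
Proof.
rewrite -(@coboundary_high _ _ _ bG z _ (- (i + 1) + N%:Z)) //.
by rewrite opprD addrAC.
Qed.

(** G has nothing in degree N + 1. *)
Lemma top_cocycle z (psi : global_dual (G kG) z) : cocyc (X := cmx bG) (high (- z)) (dcol bG psi).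
Proof.
split=> [|i]; first exact: dcol_high.
have [->|ik] := eqVneq i (kG + 1); last by rewrite mD_shape // mul0mx.
apply/colP => a; exfalso; case: a => a; rewrite G_long //; lia.
Qed.

(** In positive degrees the link with G in negative degrees shows that all
    cocycles are coboundaries; in degree 0 the transfer is the augmentation. *)
Lemma dual_resolution : resolution DG (homology X d).
Proof.
split=> [i i0 z psi|].
  have n0 : mx_dim bG (- i + N%:Z) = 0%N by apply: G_long; lia.
  apply: (@dcol_inj _ _ _ bG z (- i + N%:Z)).
  by apply/colP => a; exfalso; case: a => a; rewrite n0.
have [rX hX] := X_link; have [|rG hG] := @G_link 0 kG; first by rewrite oppr0.
pose T := @transfer F N (cmx bX) (cmx bG) d kX 0 kG rX rG aug.
pose R z (psi : DG 0 z) (h : homology X d z) : Prop :=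
  exists2 x, has_class x h & T z (dcol bG (psi : global_dual (G kG) z)) (coords bX x).
have dom := transfer_dom hX hG aug_cyc aug_coc aug_lin aug_cod aug_bnd.
have cod := transfer_cod hX hG aug_lin aug_dom aug_bnd.
have tbnd := transfer_bnd hX hG aug_cyc aug_coc aug_dom aug_cod.
have Rb z psi h : R z psi h -> h = 0 <-> exists phi, cdiff DG (0 + 1) 0 z phi = psi.
  move=> [x xh t]; apply: iff_trans (cls0 xh) _.
  apply: iff_trans (boundary_low bX x) _; apply: iff_trans (tbnd _ _ _ t) _.
  exact: iff_sym (@DG_coboundary 0 z psi).
have [||||f fR] := @hom_of_rel F N (DG 0) (homology X d) R.
- move=> z a psi psi' h h' [x xh t] [x' xh' t']; exists (a *: x + x').
    exact: cls_lin.
  by rewrite coords_lin /= dcol_lin; apply: transfer_lin.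
- move=> z psi; have [x t] := dom _ _ (top_cocycle (psi : global_dual (G kG) z)).
  have cx : cyc (low z) x by case: t.
  have [x' xx'] := @coords_surj _ _ _ bX z d x cx.1.
  have [|h xh] := @cls_of _ _ X d z x'.
    by apply/cyc_cdiff/(cycle_low bX); rewrite xx'.
  by exists h, x' => //; rewrite xx'.
- move=> z h /Rb ->; exists 0; exact: linear0.
- move=> z w zw psi h [x xh t]; exists (pmap (X d) zw x); first exact: cls_nat.
  rewrite coords_nat /= (@dcol_nat _ _ _ bG z w kG).
  apply: (transfer_nat hX hG aug_coc aug_nat zw t).
    rewrite -(coords_nat _ zw); apply/cycle_low/cyc_cdiff.
    by apply: cls_cyc; apply: cls_nat xh.
  rewrite -(@dcol_nat _ _ _ bG z w kG zw); exact: top_cocycle.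
exists f; split.
- move=> z h; have [x xh] := cls_ex h.
  have [|psi t] := cod z (coords bX x).
    by apply/cycle_low/cyc_cdiff; apply: cls_cyc xh.
  have [psi' pp] := @dcol_surj _ _ _ bG z kG psi (let: And3 _ c _ := t in c.1).
  by exists psi'; apply/fR; exists x => //; rewrite pp.
- by move=> z psi; apply: (Rb z psi); apply/fR.
- move=> i i0 z psi; split; last by move=> [phi <-]; apply: cdiffK.
  move=> /DG_cocycle cp; apply/DG_coboundary; apply: cyc_cob; first exact: cp.1.
  have [r hr] := @G_link (- i) (- i + N%:Z) erefl.
  move=> v /(link_cod hr)[u uv]; rewrite (bnd_cocyc _ cp) ?mxE //.
  apply/(link_bnd hr uv)/exact_neg; first by lia.
  exact: link_l uv.
Qed.

End Augmentation.

(** The boundary matrix of the dual complex is the transpose, and dual grades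
    are equal when the grades are. *)
Lemma dual_min_resolution :
  min_free_resolution (cdual (cshift G N%:Z)) (homology X d).
Proof.
split.
- move=> i; exact: basis_finite_free (dual_basis (bG (- i + N%:Z))).
- by case: (Gres.2) => eps [e1 e2 _]; apply: (dual_resolution e1 e2).
pose b i : basis (cdual (cshift G N%:Z) i) := dual_basis (bG (- i + N%:Z)).
apply: (@no_units_minimal _ _ _ b) => i j a c ac.
rewrite /hmx /= /dco global_dual_homE hcompE (dcoE (bG (- i + N%:Z))).
apply: big1 => k _; have := co_bv (b := b i) (bgr a) a k.
rewrite [co _ _ _]/= => ->; have [->|_] := eqVneq k a; last by rewrite mulr0.
rewrite (_ : co _ _ _ = 0) ?mul0r //.
apply: (minimal_no_units (b := bG) Gmin).
by move: ac; rewrite /= /dgr => /addrI/oppr_inj ->.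
Qed.

End Duality.

(** * The functor R preserves minimal resolutions *)

(** R evaluates at other grades, so it preserves exactness, and it discards the
    basis elements that are not below zeta without changing the other matrix
    entries. *)
Lemma R_min_resolution (F : fieldType) (N : nat) (zeta : grade N)
  (D : complex F N) (M : pmod F N) :
  min_free_resolution D M -> min_free_resolution (cR zeta D) (pR zeta M).
Proof.
move=> [Dfree [Dneg [eps [e1 e2 e3]]] Dmin].
have H i : exists b : basis (D i), True.
  by have [Q /basis_rank[b _]] := Dfree i; exists b.
pose b i : basis (D i) := sval (cid (H i)).
split.
- move=> i; exact: basis_finite_free (R_basis zeta (b i)).
- split=> [i i0 z x|]; first exact: Dneg.
  exists (pR_hom zeta eps); split.
  + by move=> z y; apply: e1.
  + by move=> z x; apply: e2.
  + by move=> i i0 z x; apply: e3.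
pose bR i : basis (cR zeta D i) := R_basis zeta (b i).
apply: (@no_units_minimal _ _ _ bR) => i j a c ac.
pose v : D i (zmeet (bgr a) zeta) := bv (bR i) (bgr a) a.
have -> : hmx (bR i) (bR j) (cdiff (cR zeta D) i j) a c =
    co (b j) (cdiff D i j _ v) (val c) by [].
rewrite (hmxE (b i)); apply: big1 => k _.
have [->|nk] := eqVneq (co (b i) v k) 0; first by rewrite mul0r.
have kz : zle (bgr k) zeta.
  apply/zleP => m; have /zleP/(_ m) := co_supp nk.
  by rewrite ffunE le_min => /andP[].
pose k' : bidx (bR i) := exist _ k kz.
have vk : co (b i) v k = ((k' == a) && zle (bgr a) (bgr a))%:R := co_bv (bgr a) a k'.
move: nk; rewrite vk; have [ka _|_] := eqVneq k' a; last by rewrite eqxx.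
rewrite (minimal_no_units (b := b) Dmin) ?mulr0 //.
by rewrite -[bgr k]/(bgr k') ka; exact: ac.
Qed.

(** * The complex whose homology is bounded above *)

Section Hat.
Variables (F : fieldType) (N : nat) (zeta : grade N) (C : complex F N).

Local Notation X := (hat zeta C).

Lemma solve_sign (V : lmodType F) (t m : F) (u a z : V) :
  t * t = 1 -> t *: u + a + m *: z = 0 -> - t *: a + (- m) *: (t *: z) = u.
Proof.
move=> tt h; have -> : a = - (t *: u + m *: z).
  by apply/eqP; rewrite -addr_eq0 addrCA addrA h.
rewrite scaleNr scalerN opprK scalerDr !scalerA tt scale1r mulNr scaleNr.
by rewrite [m * t]mulrC -addrA subrr addr0.
Qed.

(** Where coordinate i exceeds that of zeta, adjoining i to the index sets
    contracts the complex. *)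
Lemma hat_exact w d (x : X d w) : ~~ zle w zeta ->
  cdiff X d (d - 1) w x = 0 -> exists y, cdiff X (d + 1) d w y = x.
Proof.
move=> wz x0; have [i iw] : exists i, zeta i < w i.
  by move: wz => /forallPn[i]; rewrite -ltNge; exists i.
have ab S : above zeta S w = above zeta (S :\ i) w.
  apply/forall_inP/forall_inP => h k.
    by rewrite !inE => /andP[_]; apply: h.
  by have [->//|ki] := eqVneq k i; move=> kS; apply: h; rewrite !inE ki.
(* The components of x, with the degree as a separate argument, so that equal
   index sets can be exchanged. *)
pose Y (S : {set 'I_N}) k := ccast C (d - #|S|%:Z) k w (val (x S)).
(* The contraction; its signs are those of the inclusions that it inverts. *)
pose h (S : {set 'I_N}) : C (d + 1 - #|S|%:Z) w :=
  if i \in S then (-1) ^+ position i S *: Y (S :\ i) (d + 1 - #|S|%:Z) else 0.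
have hP (S : {set 'I_N}) : if_submod (C (d + 1 - #|S|%:Z) w) (above zeta S w) (h S).
  move=> /= n; rewrite /h; case: ifP => // _; rewrite /Y.
  have -> : val (x (S :\ i)) = 0 by apply: (subm_in (x (S :\ i))); rewrite -ab.
  by rewrite (linear0 (hom_lin (ccast C _ _) w)) scaler0.
pose y : X (d + 1) w := (fun S => mkSub (hP S)) : hat_obj zeta C (d + 1) w.
pose e (s : 'I_N) (U : {set 'I_N}) : F := (-1) ^+ position s (s |: U).
have ee s U : e s U * e s U = 1 by rewrite /e -expr2 sqrr_sign.
exists y; apply: functional_extensionality_dep => T; apply: val_inj.
rewrite [LHS]hat_diffE.
have YT : Y T (d - #|T|%:Z) = val (x T) by rewrite /Y ccast_id.
have castY (s : 'I_N) (S : {set 'I_N}) : s \notin T ->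
    ccast C (d + 1 - #|s |: T|%:Z) (d - #|T|%:Z) w (Y S (d + 1 - #|s |: T|%:Z)) =
    Y S (d - #|T|%:Z).
  by move=> sT; rewrite /Y ccast_comp //; right; apply: deg_setU1.
have [iT|iT] := boolP (i \in T); last first.
  have -> : val (y T) = 0 by rewrite /= /h (negPf iT).
  rewrite (linear0 (hom_lin _ w)) scaler0 addr0.
  rewrite (bigD1 i) //= big1 => [|s /andP[sT si]].
    rewrite addr0 /h setU11 (linearZ_LR (hom_lin (ccast C _ _) w)) /= castY //.
    by rewrite setU1K // YT scalerA -[_ * _]/(e i T * e i T) ee scale1r.
  rewrite /h in_setU1 eq_sym (negPf si) (negPf iT).
  by rewrite (linear0 (hom_lin (ccast C _ _) w)) scaler0.
pose U := T :\ i.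
have TE : T = i |: U by rewrite setD1K.
have iU : i \notin U by rewrite !inE eqxx.
have cT : #|T| = #|U|.+1 by rewrite TE card_setU1.
have dT : d - 1 - #|U|%:Z = d - #|T|%:Z by rewrite cT -addrA -opprD.
have dT' : d - #|U|%:Z = d + 1 - #|T|%:Z.
  by rewrite cT -addn1 PoszD opprD addrACA subrr addr0.
pose Z := ccast C (d - 1 - #|U|%:Z) (d - #|T|%:Z) w
  (cdiff C (d - #|U|%:Z) (d - 1 - #|U|%:Z) w (val (x U))).
(* The vanishing of the component at U of the boundary of x. *)
have E : e i U *: val (x T) + \sum_(s | s \notin T) e s U *: Y (s |: U) (d - #|T|%:Z)
    + (-1) ^+ #|U| *: Z = 0.
  have x0U : val (hat_diff zeta C d (d - 1) w x U) = 0.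
    by rewrite -[hat_diff _ _ _ _]/(cdiff X d (d - 1)) x0.
  rewrite hat_diffE in x0U.
  have := congr1 (hom_at (ccast C (d - 1 - #|U|%:Z) (d - #|T|%:Z)) w) x0U.
  rewrite (linear0 (hom_lin (ccast C _ _) w)) => xU; apply: etrans xU.
  rewrite (linearD (hom_lin (ccast C _ _) w)) /=.
  rewrite (linear_sum (hom_lin (ccast C _ _) w)) /=.
  rewrite (linearZ_LR (hom_lin (ccast C _ _) w)) /=; congr (_ + _).
  have eU s : s \notin U -> e s U *: Y (s |: U) (d - #|T|%:Z) =
      ccast C (d - 1 - #|U|%:Z) (d - #|T|%:Z) w ((-1) ^+ position s (s |: U) *:
      ccast C (d - #|s |: U|%:Z) (d - 1 - #|U|%:Z) w (val (x (s |: U)))).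
    move=> sU; rewrite (linearZ_LR (hom_lin (ccast C _ _) w)) /= ccast_comp //.
    by right; apply: dT.
  rewrite [RHS](bigD1 i) //= -eU // -TE YT; congr (_ + _).
  apply: eq_big => [s|s sT].
    by rewrite !inE; case: (s =P i) => [->|]; rewrite ?iT ?andbF ?andbT.
  by rewrite eU //; apply: contra sT; rewrite !inE => /andP[].
have sgn s : s \notin T -> e s T * (-1) ^+ position i (s |: T) = - e i U * e s U.
  move=> sT; have sU : s \notin U by apply: contra sT; rewrite !inE => /andP[].
  have si : s != i by apply: contraNneq sT => ->.
  have A : e s U * e i (s |: U) = - (e i U * e s (i |: U)).
    rewrite /e; have [lt|lt|/val_inj eq] := ltngtP s i.
    - exact: position_anti.
    - by rewrite (position_anti F iU sU lt) opprK.
    - by rewrite eq eqxx in si.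
  rewrite TE -/(e s (i |: U)) setUCA -/(e i (s |: U)).
  have -> : e s (i |: U) = - (e i U * (e s U * e i (s |: U))).
    by rewrite A mulrN opprK mulrA ee mul1r.
  by rewrite mulNr -!mulrA ee mulr1 mulNr.
have -> : val (y T) = e i U *: Y U (d + 1 - #|T|%:Z) by rewrite /= /h iT /e -TE.
have -> : cdiff C (d + 1 - #|T|%:Z) (d - #|T|%:Z) w (e i U *: Y U (d + 1 - #|T|%:Z)) =
    e i U *: Z.
  rewrite (linearZ_LR (hom_lin (cdiff C _ _) w)) /=; congr (_ *: _).
  by rewrite /Z; apply: ccast_diff.
have -> : \sum_(s | s \notin T) (-1) ^+ position s (s |: T) *:
    ccast C (d + 1 - #|s |: T|%:Z) (d - #|T|%:Z) w (val (y (s |: T))) =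
    - e i U *: \sum_(s | s \notin T) e s U *: Y (s |: U) (d - #|T|%:Z).
  rewrite scaler_sumr; apply: eq_bigr => s sT.
  rewrite /= /h in_setU1 iT orbT (linearZ_LR (hom_lin (ccast C _ _) w)) /= castY //.
  rewrite !scalerA -/(e s T) sgn //; congr (_ *: Y _ _).
  apply/setP => k; rewrite !inE; case: (k =P s) => [->|//]; rewrite andbT.
  by apply: contraNneq sT => ->.
have -> : (-1) ^+ #|T| = - (-1) ^+ #|U| :> F by rewrite cT exprS mulN1r.
exact: solve_sign (ee i U) E.
Qed.

(* The projection to the summand with S = set0; it is a chain map at the grades
   below zeta, where the other summands vanish. *)
Definition hat_proj i : Hom (X i) (C i) :=
  hcomp (ccast C (i - #|set0 : {set 'I_N}|%:Z) i)
    (hcomp (psub_val _) (dsum_proj (fun S => PS zeta S (C (i - #|S|%:Z))) set0)).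

Lemma hat_projE i w (x : X i w) :
  hat_proj i w x = ccast C (i - #|set0 : {set 'I_N}|%:Z) i w (val (x set0)).
Proof. by []. Qed.

Lemma above_low S w : zle w zeta -> above zeta S w = (S == set0).
Proof.
move=> /zleP wz; apply/forall_inP/eqP => [h|-> k]; last by rewrite inE.
apply/setP => k; rewrite inE; apply/negP => /h; rewrite ltNge; move: (wz k) => -> //.
Qed.

Lemma hat_low i w (x : X i w) S : zle w zeta -> S != set0 -> val (x S) = 0.
Proof. by move=> wz S0; apply: (subm_in (x S)); rewrite above_low. Qed.

Lemma deg_set0 (i : int) : i - #|set0 : {set 'I_N}|%:Z = i.
Proof. by rewrite cards0 subr0. Qed.

Lemma hat_proj_diff i j w (x : X i w) : zle w zeta ->
  hat_proj j w (cdiff X i j w x) = cdiff C i j w (hat_proj i w x).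
Proof.
move=> wz; rewrite !hat_projE [cdiff X _ _]/= hat_diffE big1 => [|s _].
  rewrite add0r; have -> : (-1) ^+ #|set0 : {set 'I_N}| = 1 :> F by rewrite cards0.
  by rewrite scale1r; symmetry; apply: ccast_diff; apply: deg_set0.
rewrite hat_low //; last by apply/set0Pn; exists s; rewrite setU11.
by rewrite (linear0 (hom_lin (ccast C _ _) w)) scaler0.
Qed.

Lemma hat_proj_inj i w (x : X i w) : zle w zeta -> hat_proj i w x = 0 -> x = 0.
Proof.
move=> wz x0; apply: functional_extensionality_dep => S; apply: val_inj.
have [->|S0] := eqVneq S set0; last exact: hat_low.
have := congr1 (hom_at (ccast C i (i - #|set0 : {set 'I_N}|%:Z)) w) x0.
rewrite hat_projE ccast_comp; last by left; apply: deg_set0.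
by rewrite ccast_id (linear0 (hom_lin (ccast C _ _) w)).
Qed.

Lemma hat_proj_surj i w (c : C i w) : zle w zeta -> exists x : X i w, hat_proj i w x = c.
Proof.
move=> wz.
have P (S : {set 'I_N}) : if_submod (C (i - #|S|%:Z) w) (above zeta S w)
    (if S == set0 then ccast C i (i - #|S|%:Z) w c else 0).
  by rewrite /= above_low // => /negPf ->.
exists ((fun S => mkSub (P S)) : hat_obj zeta C i w).
rewrite hat_projE /= eqxx ccast_comp ?ccast_id //; right; exact: deg_set0.
Qed.

Variable bC : forall j, basis (C j).
Hypothesis bCz : forall j (a : bidx (bC j)), zle (bgr a) zeta.

Definition hat_basis j : basis (X j) :=
  @dsum_basis F N _ (fun S : {set 'I_N} => PS zeta S (C (j - #|S|%:Z)))
    (fun S => PS_basis zeta (bC (j - #|S|%:Z)) S).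

Fact meetl z : zle (zmeet z zeta) z.
Proof. by apply/zleP => k; rewrite ffunE ge_min lexx. Qed.

Fact meetr z : zle (zmeet z zeta) zeta.
Proof. by apply/zleP => k; rewrite ffunE ge_min lexx orbT. Qed.

(* The component at z of the isomorphism from R of the hat complex to C. *)
Definition hat_comp_at z i (x : X i (zmeet z zeta)) : C i z :=
  pmap (C i) (meetl z) (hat_proj i _ x).

Lemma hat_comp_lin z i a (x y : X i (zmeet z zeta)) :
  hat_comp_at (a *: x + y) = a *: hat_comp_at x + hat_comp_at y.
Proof. by rewrite /hat_comp_at hom_linear linearP. Qed.

Lemma hat_comp_diff z i j (x : X i (zmeet z zeta)) :
  hat_comp_at (cdiff X i j _ x) = cdiff C i j z (hat_comp_at x).
Proof. by rewrite /hat_comp_at hat_proj_diff ?meetr // hom_nat. Qed.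

Lemma hat_comp_nat z w (h : zle z w) i (x : X i (zmeet z zeta)) :
  hat_comp_at (pmap (X i) (zle_meet zeta h) x) = pmap (C i) h (hat_comp_at x).
Proof.
have h3 : zle (zmeet z zeta) w by apply: zle_trans (meetl z) h.
by rewrite /hat_comp_at hom_nat (pmap_comp _ _ h3) (pmap_comp _ _ h3).
Qed.

Lemma hat_comp_inj z i (x : X i (zmeet z zeta)) : hat_comp_at x = 0 -> x = 0.
Proof.
move=> x0; apply: (hat_proj_inj (meetr z)); apply: (co_inj (bC i)) => a.
by rewrite -(co_nat _ (meetl z)) -/(hat_comp_at x) x0 !co0.
Qed.

(** Surjective since the basis elements of C are below zeta. *)
Lemma hat_comp_surj z i (c : C i z) : exists x, hat_comp_at x = c.
Proof.
have [|c' cc'] := @co_surj _ _ _ (bC i) (zmeet z zeta) (co (bC i) c).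
  move=> a /co_supp/zleP az; apply/zleP => k; rewrite ffunE le_min az /=.
  by move/zleP: (bCz a) => ->.
have [x xc] := hat_proj_surj c' (meetr z); exists x; apply: (co_inj (bC i)) => a.
by rewrite /hat_comp_at xc co_nat cc'.
Qed.

(** The isomorphism on chains at every grade induces one on homology. *)
Lemma R_homology_hat d : exists f : Hom (pR zeta (homology X d)) (homology C d),
  (forall z x, f z x = 0 -> x = 0) /\ (forall z y, exists x, f z x = y).
Proof.
pose R z (h : pR zeta (homology X d) z) (k : homology C d z) : Prop :=
  exists2 x : X d (zmeet z zeta), has_class (D := X) x h & has_class (hat_comp_at x) k.
have R0 z h k : R z h k -> h = 0 <-> k = 0.
  move=> [x xh xk]; apply: iff_trans (cls0 xh) _.
  apply: iff_trans (iff_sym (cls0 xk)); split=> [[y <-]|[y yx]].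
    by exists (hat_comp_at y); rewrite hat_comp_diff.
  have [y' y'y] := hat_comp_surj y; exists y'.
  apply/eqP; rewrite -subr_eq0; apply/eqP/hat_comp_inj.
  have -> : cdiff X (d + 1) d _ y' - x = (-1) *: x + cdiff X (d + 1) d _ y'.
    by rewrite scaleN1r addrC.
  by rewrite hat_comp_lin hat_comp_diff y'y yx scaleN1r addNr.
have [||||f fR] := @hom_of_rel F N _ _ R.
- move=> z a h h' k k' [x xh xk] [x' xh' xk']; exists (a *: x + x').
    exact: (cls_lin a xh xh').
  by rewrite hat_comp_lin; apply: cls_lin.
- move=> z h; have [x xh] := @cls_ex _ _ X d _ h.
  have [|k xk] := @cls_of _ _ C d z (hat_comp_at x).
    have x0 := cls_cyc xh; rewrite -hat_comp_diff x0.
    have := hat_comp_lin (-1) (0 : X (d - 1) (zmeet z zeta)) 0.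
    by rewrite !scaleN1r !addNr.
  by exists k, x.
- by move=> z k /R0 [/(_ erefl)].
- move=> z w zw h k [x xh xk]; exists (pmap (X d) (zle_meet zeta zw) x).
    exact: (cls_nat (zle_meet zeta zw) xh).
  by rewrite hat_comp_nat; apply: cls_nat.
exists f; split=> [z h fh|z k]; first by apply/(R0 z h 0) => //; apply/fR.
have [c ck] := cls_ex k; have [x xc] := hat_comp_surj c.
have [|h xh] := @cls_of _ _ X d _ x.
  by apply: hat_comp_inj; rewrite hat_comp_diff xc; apply: cls_cyc ck.
by exists h; apply/fR; exists x => //; rewrite xc.
Qed.

End Hat.

Lemma resolution_iso (F : fieldType) (N : nat) (D : complex F N) (M L : pmod F N)
  (f : Hom M L) :
  (forall z x, f z x = 0 -> x = 0) -> (forall z y, exists x, f z x = y) ->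
  min_free_resolution D M -> min_free_resolution D L.
Proof.
move=> finj fsurj [Dfree [Dneg [eps [e1 e2 e3]]] Dmin]; split=> //; split=> //.
exists (hcomp f eps); split=> // z.
  move=> y; have [x <-] := fsurj z y; have [u <-] := e1 z x.
  by exists u.
move=> u; rewrite hcompE; apply: iff_trans (e2 z u); split=> [/finj//|->].
exact: (linear0 (hom_lin f z)).
Qed.

Theorem corollary1p6 (F : fieldType) (N : nat) (d : int) (C : complex F N)
    (zeta : grade N) (G : complex F N)
    (hC : finite_total_rank C)
    (hzeta : forall (e : int) (Q : seq (grade N)) (z : grade N),
       has_rank (C e) Q -> z \in Q -> zle z zeta)
    (hG : min_free_resolution G
       (cohomology (cdual (hat zeta C)) (d + Posz N)%R)) :
  min_free_resolution (cR zeta (cdual (cshift G (Posz N)))) (homology C d).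
Proof.
case: hC => rk [rkC _].
have H j : exists b : basis (C j), forall a : bidx b, zle (bgr a) zeta.
  have [b bQ] := basis_rank (rkC j); exists b => a.
  exact: hzeta (rkC j) (bQ a).
pose bC j : basis (C j) := sval (cid (H j)).
have bCz j (a : bidx (bC j)) : zle (bgr a) zeta := proj2_sig (cid (H j)) a.
have [Gfree Gres Gmin] := hG.
have K j : exists b : basis (G j), True.
  by have [Q /basis_rank[b _]] := Gfree j; exists b.
pose bG j : basis (G j) := sval (cid (K j)).
have [f [finj fsurj]] := R_homology_hat bCz d.
apply: resolution_iso finj fsurj _; apply: R_min_resolution.
apply: (@dual_min_resolution F N (hat zeta C) G d zeta (hat_basis zeta bC) bG) => //.
move=> w wz j x; exact: hat_exact.
Qed.
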